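(* Let $M=(M_k)$ be a weight sequence and let $C^{[M]}$ denote either $C^{(M)}$ or $C^{\{M\}}$. Let $E,F,G$ be convenient vector spaces and let $U\subseteq F$ be $c^\infty$-open. A linear mapping $T:E\to C^{[M]}(U,G)$ is bounded (i.e. maps bounded sets to bounded sets) if and only if $\operatorname{ev}_x\circ T:E\to G$ is bounded for every $x\in U$, where $\operatorname{ev}_x(f)=f(x)$.
   Context: $\mathbb N=\{0,1,2,\dots\}$. A weight sequence $M=(M_k)_{k\in\mathbb N}$ is a sequence of positive reals with $M_0=1\le M_1$. $C^{[M]}$ stands, within one statement, either everywhere for $C^{(M)}$ or everywhere for $C^{\{M\}}$. Jets on Banach spaces. For Banach spaces $E,F$ let $L^k_{\rm sym}(E,F)$ be the Banach space of bounded symmetric $k$-linear maps $E^k\to F$ with the operator norm. For compact $K\subseteq E$ and $f=(f^k)_k\in\prod_k C(K,L^k_{\rm sym}(E,F))$ put $\|f\|_k=\sup_{x\in K}\|f^k(x)\|$, $(R^n_yf)^k(x)=f^k(x)-\sum_{j=0}^n\frac1{j!}f^{j+k}(y)(x-y,\dots,x-y,\cdot)$, $|||f|||_{n,k}=\sup\{(n+1)!\,\|(R^n_yf)^k(x)\|/\|x-y\|^{n+1}:x\ne y\in K\}$, and $$\|f\|_\rho=\max\Big\{\sup_m\frac{\|f\|_m}{m!\rho^mM_m},\ \sup_{n,k}\frac{|||f|||_{n,k}}{(n+k+1)!\rho^{n+k+1}M_{n+k+1}}\Big\}.$$ $C^M_\rho(E\supseteq K,F)$ is the space of those $f$ with $\|f\|_\rho<\infty$,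 normed by $\|\cdot\|_\rho$. For compact convex $K$ put $C^{(M)}(E\supseteq K,F)=\varprojlim_{\rho>0}C^M_\rho(E\supseteq K,F)$ and $C^{\{M\}}(E\supseteq K,F)=\varinjlim_{\rho>0}C^M_\rho(E\supseteq K,F)$ (locally convex limits). For open $U\subseteq E$, $C^{[M]}(U,F)$ is the space of all $C^\infty$ (Fréchet) maps $f:U\to F$ with $j^\infty f|_K=(f^{(k)}|_K)_k\in C^{[M]}(E\supseteq K,F)$ for all compact convex $K\subseteq U$, with the initial locally convex topology induced by the maps $f\mapsto j^\infty f|_K$. Convenient vector spaces. A convenient vector space is a real Hausdorff locally convex space that is Mackey complete. Its $c^\infty$-topology is the final topology with respect to all $C^\infty$-curves $\mathbb R\to E$. A mapping on a $c^\infty$-open set is $C^\infty$ if it maps $C^\infty$-curves to $C^\infty$-curves. $F^*$ is the space of continuous linear functionals. For closed absolutely convex bounded $B\subseteq E$, $E_B$ is the span of $B$ with the Minkowski functional of $B$ as norm (a Banach space), $i_B:E_B\to E$ the inclusion, $U_B=U\cap E_B$. For $c^\infty$-open $U\subseteq E$, $$C^{[M]}(U,F)=\{f\in C^\infty(U,F):\ell\circ f\circ i_B\in C^{[M]}(U_B,\mathbb R)\ \forall\ell\in F^*,\forall B\},$$ with the initial locally convex structure induced by all maps $f\mapsto\ell\circ f\circ i_B\in C^{[M]}(U_B,\mathbb R)$; this is a convenient vector space. *)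

(* Defs.v *)
From HB Require Import structures.
From mathcomp Require Import all_boot all_order all_algebra all_fingroup.
From mathcomp Require Import all_classical all_reals all_analysis.

Set Implicit Arguments.
Unset Strict Implicit.
Unset Printing Implicit Defensive.

Import Order.TTheory GRing.Theory Num.Theory.
Import numFieldNormedType.Exports.

Local Open Scope classical_set_scope.
Local Open Scope ring_scope.

Definition upd (T : Type) k (v : 'I_k -> T) (i : 'I_k) (x : T) : 'I_k -> T :=
  fun j => if j == i then x else v j.

(* The argument tuple (h, ..., h, v_0, ..., v_(k-1)) with h repeated j times. *)
Definition padl (T : Type) j k (h : T) (v : 'I_k -> T) : 'I_(j + k) -> T :=
  fun i => match fintype.split i with inl _ => h | inr i' => v i' end.
Arguments padl {T} j {k} h v _.

Section lsym.
Context {R : realType} {E F : normedModType R} {k : nat}.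
Implicit Types L : ('I_k -> E) -> F.

Definition multilinear L := forall (v : 'I_k -> E) i a x y,
  L (upd v i (a *: x + y)) = a *: L (upd v i x) + L (upd v i y).

Definition symmetric_map L :=
  forall (s : {perm 'I_k}) v, L (fun i => v (s i)) = L v.

Definition bounded_multi L :=
  exists C : R, forall v, `|L v| <= C * \prod_i `|v i|.

Definition lsym_pred : {pred ('I_k -> E) -> F} := fun L =>
  `[< [/\ multilinear L, symmetric_map L & bounded_multi L] >].

Definition opnorm L : R :=
  sup [set `|L v| | v in [set v | forall i, `|v i| <= 1]].

Lemma lsym_submod_closed : submod_closed lsym_pred.
Proof.
split=> [|a L1 L2].
  apply/asboolP; split=> [v i a x y|s v|] /=.
  - by rewrite /= scaler0 addr0.
  - by [].
  - by exists 0 => v; rewrite normr0 mul0r.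
move=> /asboolP[m1 s1 [C1 b1]] /asboolP[m2 s2 [C2 b2]]; apply/asboolP; split.
- move=> v i b x y; rewrite -![(_ + _) _]/(a *: L1 _ + L2 _).
  by rewrite m1 m2 !scalerDr !scalerA [a * b]mulrC addrACA.
- by move=> s v; rewrite -![(_ + _) _]/(a *: L1 _ + L2 _) s1 s2.
- exists (`|a| * C1 + C2) => v; rewrite -![(_ + _) _]/(a *: L1 _ + L2 _).
  rewrite (le_trans (ler_normD _ _))// mulrDl lerD// normrZ -mulrA.
  by rewrite ler_wpM2l.
Qed.

HB.instance Definition _ :=
  GRing.isSubmodClosed.Build R (('I_k -> E) -> F) lsym_pred lsym_submod_closed.

End lsym.

Record Lsym (R : realType) (k : nat) (E F : normedModType R) := MkLsym {
  lsym_fun :> ('I_k -> E) -> F ;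
  lsymP : lsym_fun \in lsym_pred }.

Section lsym_normed.
Context {R : realType} {k : nat} {E F : normedModType R}.
Local Notation L := (Lsym k E F).

HB.instance Definition _ := [isSub for @lsym_fun R k E F].
HB.instance Definition _ := [Choice of L by <:].
HB.instance Definition _ := [SubChoice_isSubLmodule of L by <:].

Lemma lsym_scale (l : L) (c : 'I_k -> R) (v : 'I_k -> E) :
  l (fun i => c i *: v i) = (\prod_i c i) *: l v.
Proof.
have /asboolP[ml _ _] := lsymP l.
have scale1 w i a x : l (upd w i (a *: x)) = a *: l (upd w i x).
  have l0 : l (upd w i 0) = 0.
    have := ml w i 1 0 0; rewrite scale1r scale1r addr0.
    by move/eqP; rewrite -subr_eq0 opprD addrA subrr sub0r oppr_eq0 => /eqP.
  by have := ml w i a x 0; rewrite l0 !addr0.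
have key s : uniq s -> l (fun i => if i \in s then c i *: v i else v i) =
    (\prod_(i <- s) c i) *: l v.
  elim: s => [_|i s IH /= /andP[ins us]].
    by rewrite big_nil scale1r.
  rewrite big_cons -scalerA -IH//.
  pose w j := if j \in s then c j *: v j else v j.
  have -> : (fun j => if j \in i :: s then c j *: v j else v j) =
            upd w i (c i *: v i).
    by apply/funext => j; rewrite /upd /w inE; case: eqVneq => [->|].
  rewrite scale1; congr (_ *: l _); apply/funext => j; rewrite /upd /w.
  by case: eqVneq => [->|//]; rewrite (negbTE ins).
rewrite -big_enum -key ?enum_uniq//; congr (l _).
by apply/funext => i; rewrite mem_enum.
Qed.

Lemma opnorm_has_sup (l : L) :
  has_sup [set `|l v| | v in [set v | forall i, `|v i| <= 1]].
Proof.
split; first by exists `|l (fun=> 0)|, (fun=> 0) => //= i; rewrite normr0.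
have /asboolP[_ _ [C bl]] := lsymP l.
exists `|C| => _ [v v1 <-]; rewrite (le_trans (bl v))//.
rewrite (le_trans (ler_norm _))// normrM -[leRHS]mulr1 ler_wpM2l//.
rewrite ger0_norm ?prodr_ge0//; apply: prodr_ile1 => i _.
by rewrite normr_ge0 v1.
Qed.

Lemma opnorm_ub (l : L) v : (forall i, `|v i| <= 1) -> `|l v| <= opnorm l.
Proof. by move=> v1; apply: ub_le_sup; [exact: (opnorm_has_sup l).2|exists v]. Qed.

Lemma opnorm_ge0 (l : L) : 0 <= opnorm l.
Proof.
by rewrite (le_trans (normr_ge0 (l (fun=> 0))))// opnorm_ub// => i; rewrite normr0.
Qed.

Lemma opnormP (l : L) v : `|l v| <= opnorm l * \prod_i `|v i|.
Proof.
have := @opnorm_ub l (fun i => `|v i|^-1 *: v i) => /= H.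
have -> : v = fun i => `|v i| *: (`|v i|^-1 *: v i).
  apply/funext => i; have [->|vi0] := eqVneq (v i) 0; first by rewrite !scaler0.
  by rewrite scalerA divff ?normr_eq0// scale1r.
rewrite (lsym_scale _ (fun i => `|v i|)) normrZ mulrC.
rewrite normr_prod.
have -> : \prod_i `| `|v i| | = \prod_i `| `|v i| *: (`|v i|^-1 *: v i)|.
  apply: eq_bigr => i _; have [->|vi0] := eqVneq (v i) 0.
    by rewrite !scaler0 !normr0.
  by rewrite scalerA divff ?normr_eq0// scale1r normr_id.
rewrite ler_wpM2r ?prodr_ge0// H// => i; rewrite normrZ normfV normr_id.
have [->|vi0] := eqVneq (v i) 0; first by rewrite normr0 mulr0.
by rewrite mulVf ?normr_eq0.
Qed.

Let ler_opnormD (l1 l2 : L) : opnorm (l1 + l2 : L) <= opnorm l1 + opnorm l2.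
Proof.
apply: sup_le_ub; first exact: (opnorm_has_sup (l1 + l2)).1.
by move=> _ [v v1 <-]; rewrite (le_trans (ler_normD _ _)) ?lerD ?opnorm_ub.
Qed.

Let opnormZ (a : R) (l : L) : opnorm (a *: l : L) = `|a| * opnorm l.
Proof.
have le b (m : L) : opnorm (b *: m : L) <= `|b| * opnorm m.
  apply: sup_le_ub; first exact: (opnorm_has_sup (b *: m)).1.
  move=> _ [v v1 <-]; rewrite -[(lsym_fun _) v]/(b *: m v) normrZ.
  by rewrite ler_wpM2l// opnorm_ub.
apply/eqP; rewrite eq_le le andTb; have [->|a0] := eqVneq a 0.
  by rewrite normr0 mul0r; exact: opnorm_ge0.
have := le a^-1 (a *: l); rewrite scalerA mulVf// scale1r normfV.
by rewrite ler_pdivlMl ?normr_gt0.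
Qed.

Let opnorm_eq0 (l : L) : opnorm l = 0 -> l = 0.
Proof.
move=> l0; apply/val_inj/funext => v /=; apply/eqP; rewrite -normr_le0.
by rewrite (le_trans (opnormP l v))// l0 mul0r.
Qed.

HB.instance Definition _ := @Lmodule_isNormed.Build R L
  (fun l : L => opnorm l) ler_opnormD opnormZ opnorm_eq0.

End lsym_normed.

Section lsym_plug.
Context {R : realType} {E F : normedModType R} (j k : nat).

Lemma lsym_plug_subproof (l : Lsym (j + k) E F) (h : E) :
  (fun v : 'I_k -> E => l (padl j h v)) \in lsym_pred.
Proof.
have /asboolP[ml sl _] := lsymP l; apply/asboolP; split.
- have H v i x : padl j h (upd v i x) = upd (padl j h v) (rshift j i) x.
    apply/funext => a; rewrite /padl /upd; case: (split_ordP a) => b ->.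
      by rewrite eq_lrshift.
    by rewrite (inj_eq (@rshift_inj _ _)).
  by move=> v i a x y; rewrite !H ml.
- move=> s v.
  pose g (a : 'I_(j + k)) := match fintype.split a with
    inl b => lshift k b | inr b => rshift j (s b) end.
  have injg : injective g.
    move=> a b; rewrite /g; case: (split_ordP a) => c ->; case: (split_ordP b) => d ->.
    - by move/lshift_inj ->.
    - by move/eqP; rewrite eq_lrshift.
    - by move/eqP; rewrite eq_rlshift.
    - by move/rshift_inj/perm_inj ->.
  rewrite -(sl (perm injg) (padl j h v)); congr (l _).
  apply/funext => a; rewrite permE /padl /g; case: (split_ordP a) => c _.
    by case: (split_ordP (lshift k c)) => d /eqP; rewrite ?eq_lrshift.
  case: (split_ordP (rshift j (s c))) => d /eqP; rewrite ?eq_rlshift//.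
  by rewrite eq_rshift => /eqP ->.
- exists (opnorm l * `|h| ^+ j) => v; rewrite (le_trans (opnormP _ _))//.
  rewrite big_split_ord/= -mulrA ler_wpM2l ?opnorm_ge0//.
  rewrite le_eqVlt; apply/orP; left; apply/eqP; congr (_ * _).
    under eq_bigr do rewrite /padl (unsplitK (inl _)).
    by rewrite prodr_const card_ord.
  by apply: eq_bigr => i _; rewrite /padl (unsplitK (inr _)).
Qed.

Definition lsym_plug (l : Lsym (j + k) E F) (h : E) : Lsym k E F :=
  MkLsym (lsym_plug_subproof l h).

End lsym_plug.
Arguments lsym_plug {R E F} j {k} l h.

Definition absconvex (R : realType) (V : lmodType R) (A : set V) :=
  A !=set0 /\ forall (a b : R) x y, `|a| + `|b| <= 1 -> A x -> A y ->
    A (a *: x + b *: y).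

(* A locally convex space whose underlying vector space is a subspace of V,
   given by this subspace and by its neighbourhoods of 0. Supersets in V of
   neighbourhoods of 0 are kept; only their trace on the carrier matters. *)
Record lcs (R : realType) (V : lmodType R) := Lcs {
  lcs_carrier : set V ;
  lcs_nbhs0 : set_system V }.

Definition lcs_of_tvs (R : realType) (V : tvsType R) : lcs V :=
  Lcs setT (nbhs (0 : V)).

Definition lcs_bounded (R : realType) (V : lmodType R) (X : lcs V)
    (A : set V) :=
  A `<=` lcs_carrier X /\ forall N, lcs_nbhs0 X N ->
    exists2 r : R, 0 < r & A `<=` [set r *: x | x in N].

Definition bounded_map (R : realType) (V W : lmodType R) (X : lcs V)
    (Y : lcs W) (f : V -> W) :=
  forall A, lcs_bounded X A -> lcs_bounded Y (f @` A).

(* p is meant to be a norm on the vectors of S at which it is finite. *)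
Definition lcs_normed (R : realType) (V : lmodType R) (S : set V)
    (p : V -> \bar R) : lcs V :=
  let X := [set v | S v /\ (p v < +oo)%E] in
  Lcs X [set N | exists2 e : R, 0 < e & X `&` [set v | (p v < e%:E)%E] `<=` N].

Definition lcs_initial (R : realType) (V : lmodType R) (S : set V)
    (I : Type) (D : set I) (W : I -> lmodType R) (f : forall i, V -> W i)
    (X : forall i, lcs (W i)) : lcs V :=
  Lcs [set v | S v /\ forall i, D i -> lcs_carrier (X i) (f i v)]
      (smallest Filter
        (\bigcup_(i in D) [set f i @^-1` N | N in lcs_nbhs0 (X i)])).

(* Projective and inductive limits of subspaces of V ordered by inclusion;
   the latter is given the finest locally convex topology making all the
   inclusions continuous. *)
Definition lcs_projlim (R : realType) (V : lmodType R) (I : Type) (D : set I)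
    (X : I -> lcs V) : lcs V :=
  lcs_initial setT D (fun _ => id) X.

Definition lcs_indlim (R : realType) (V : lmodType R) (I : Type) (D : set I)
    (X : I -> lcs V) : lcs V :=
  let Y := \bigcup_(i in D) lcs_carrier (X i) in
  Lcs Y [set N | exists A, [/\ absconvex A, A `<=` Y,
    (forall i, D i -> lcs_nbhs0 (X i) A) & A `<=` N]].

Definition jet (R : realType) (E F : normedModType R) (X : Type) :=
  forall k : nat, X -> Lsym k E F.

Section jet_lmod.
Context {R : realType} {E F : normedModType R} {X : Type}.
Local Notation J := (jet E F X).
Implicit Types f g h : J.

HB.instance Definition _ := gen_eqMixin J.
HB.instance Definition _ := gen_choiceMixin J.

Let j0 : J := fun _ _ => 0.
Let jadd f g : J := fun k x => f k x + g k x.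
Let jopp f : J := fun k x => - f k x.
Let jscale (a : R) f : J := fun k x => a *: f k x.

Let jext f g : (forall k x, f k x = g k x) -> f = g.
Proof. by move=> fg; apply: functional_extensionality_dep => k; apply/funext. Qed.

Let jaddA : associative jadd.
Proof. by move=> f g h; apply: jext => k x; exact: addrA. Qed.
Let jaddC : commutative jadd.
Proof. by move=> f g; apply: jext => k x; exact: addrC. Qed.
Let jadd0 : left_id j0 jadd.
Proof. by move=> f; apply: jext => k x; exact: add0r. Qed.
Let jaddN : left_inverse j0 jopp jadd.
Proof. by move=> f; apply: jext => k x; exact: addNr. Qed.

HB.instance Definition _ := GRing.isZmodule.Build J jaddA jaddC jadd0 jaddN.

Let jscaleA a b f : jscale a (jscale b f) = jscale (a * b) f.
Proof. by apply: jext => k x; exact: scalerA. Qed.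
Let jscale1 : left_id 1 jscale.
Proof. by move=> f; apply: jext => k x; exact: scale1r. Qed.
Let jscaleDr : right_distributive jscale +%R.
Proof. by move=> a f g; apply: jext => k x; exact: scalerDr. Qed.
Let jscaleDl f : {morph jscale^~ f : a b / a + b}.
Proof. by move=> a b; apply: jext => k x; exact: scalerDl. Qed.

HB.instance Definition _ :=
  GRing.Zmodule_isLmodule.Build R J jscaleA jscale1 jscaleDr jscaleDl.

End jet_lmod.

Variant flavour := Beurling | Roumieu.

Definition weight_sequence (R : realType) (M : nat -> R) :=
  [/\ forall k, 0 < M k, M 0%N = 1 & 1 <= M 1%N].

(* Supremum in [0, +oo], with value 0 on the empty set. *)
Definition sup0 (R : realType) (A : set \bar R) : \bar R :=
  ereal_sup (0%E |` A).

Section jet_spaces.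
Context {R : realType} {E F : normedModType R} (M : nat -> R).

Section norms.
Variable K : set E.
Implicit Types (f : jet E F K) (n k m : nat) (x y : K).

Definition jnorm f m : \bar R := sup0 [set (`|f m x|)%:E | x in [set: K]].

Definition jrem f n k y x : Lsym k E F :=
  f k x - \sum_(j < n.+1) (j`!%:R)^-1 *: lsym_plug j (f (j + k)%N y)
                                           (val x - val y).

Definition jremnorm f n k : \bar R :=
  sup0 [set (n.+1`!%:R * `|jrem f n k xy.2 xy.1|
              / `|val xy.1 - val xy.2| ^+ n.+1)%:E
       | xy in [set xy : K * K | xy.1 <> xy.2]].

Definition jnorm_rho (rho : R) f : \bar R :=
  maxe (sup0 [set (jnorm f m * ((m`!%:R * rho ^+ m * M m)^-1)%:E)%E
             | m in [set: nat]])
       (sup0 [set (jremnorm f nk.1 nk.2 *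
                   (((nk.1 + nk.2).+1`!%N%:R * rho ^+ (nk.1 + nk.2).+1%N
                     * M (nk.1 + nk.2).+1%N)^-1)%:E)%E
             | nk in [set: nat * nat]]).

Definition CM_rho (rho : R) : lcs (jet E F K) :=
  lcs_normed [set f : jet E F K | forall k, continuous (f k)] (jnorm_rho rho).

Definition CM_compact (b : flavour) : lcs (jet E F K) :=
  match b with
  | Beurling => lcs_projlim [set rho : R | 0 < rho] CM_rho
  | Roumieu => lcs_indlim [set rho : R | 0 < rho] CM_rho
  end.

End norms.

Section open_sets.
Variable U : set E.

(* D k extends the k-th Frechet derivative of f to E; its values outside the
   open set U are irrelevant. *)
Definition frechet_derivs (f : U -> F) (D : jet E F E) :=
  (forall (x : U) v, D 0%N (val x) v = f x) /\
  (forall k x, U x -> is_diff x (D k) (fun h => lsym_plug 1 (D (1 + k)%N x) h)).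

Definition frechet_smooth (f : U -> F) := exists D, frechet_derivs f D.

Definition jinf (K : set E) (f : U -> F) : jet E F K :=
  fun k x => xget 0 (frechet_derivs f) k (val x).

Definition CM_open (b : flavour) : lcs (U -> F) :=
  lcs_initial frechet_smooth
    [set K : set E | [/\ compact K, convex_set K & K `<=` U]]
    jinf (fun K => CM_compact K b).

End open_sets.
End jet_spaces.

Section tvs_notions.
Context {R : realType} {E : tvsType R}.

Definition mackey_cauchy (x : nat -> E) := exists B : set E,
  [/\ lcs_bounded (lcs_of_tvs E) B, absconvex B &
   exists2 mu : nat * nat -> R, mu @ (filter_prod \oo \oo) --> (0 : R) &
     forall n m, [set mu (n, m) *: b | b in B] (x n - x m)].

Definition mackey_complete :=
  forall x : nat -> E, mackey_cauchy x ->
    exists l : E, x @ \oo --> l.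

Definition smooth_curve (c : R -> E) := exists2 d : nat -> R -> E, d 0%N = c &
  forall n t, h^-1 *: (d n (t + h) - d n t) @[h --> (0 : R)^'] --> d n.+1 t.

Definition cinfty_open (U : set E) :=
  forall c : R -> E, smooth_curve c -> open (c @^-1` U).

End tvs_notions.
Arguments mackey_complete {R} E.

HB.mixin Record Tvs_isConvenient (R : realType) E of Tvs R E := {
  convenient_hausdorff : hausdorff_space E ;
  convenient_complete : mackey_complete E }.

#[short(type="convenientType")]
HB.structure Definition Convenient (R : realType) :=
  {E of Tvs_isConvenient R E & Tvs R E}.

Definition smooth_map (R : realType) (F G : tvsType R) (U : set F)
    (f : U -> G) :=
  forall c : R -> U, smooth_curve (fun t => val (c t)) ->
    smooth_curve (fun t => f (c t)).

Definition lin_span (R : realType) (V : lmodType R) (B : set V) : set V :=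
  smallest (fun S : set V => submod_closed (fun x => x \in S)) B.

Definition minkowski (R : realType) (V : lmodType R) (B : set V) (x : V) : R :=
  inf [set r | 0 < r /\ [set r *: b | b in B] x].

(* E_B below is built for all such B; Hausdorffness makes the Minkowski
   functional of B definite, and Mackey completeness makes E_B complete. *)
Record bdisk (R : realType) (E : convenientType R) := MkBdisk {
  bdisk_set : set E ;
  bdisk_closed : closed bdisk_set ;
  bdisk_absconvex : absconvex bdisk_set ;
  bdisk_bounded : lcs_bounded (lcs_of_tvs E) bdisk_set }.

Section EB_pred.
Context {R : realType} {E : convenientType R} (B : bdisk E).

Definition EB_pred : {pred E} := fun x => x \in lin_span (bdisk_set B).

Lemma EB_submod_closed : submod_closed EB_pred.
Proof.
split=> [|a x y /set_mem xB /set_mem yB]; apply/mem_set => S [Sc BS].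
  by have [/set_mem] := Sc.
by have [_ Sl] := Sc; apply/set_mem/Sl; apply/mem_set; [exact: xB|exact: yB].
Qed.

HB.instance Definition _ :=
  GRing.isSubmodClosed.Build R E EB_pred EB_submod_closed.

End EB_pred.

Record EB (R : realType) (E : convenientType R) (B : bdisk E) := MkEB {
  EB_incl : E ;
  EB_inclP : EB_incl \in EB_pred B }.

Section EB_normed.
Context {R : realType} {E : convenientType R} (B : bdisk E).

HB.instance Definition _ := [isSub for @EB_incl R E B].
HB.instance Definition _ := [Choice of EB B by <:].
HB.instance Definition _ := [SubChoice_isSubLmodule of EB B by <:].

Local Notation D := (bdisk_set B).
Local Notation S x := [set r | 0 < r /\ [set r *: b | b in D] x].

Let D0 : D 0.
Proof.
have [[x Dx] /(_ 0 0 x x)] := bdisk_absconvex B.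
by rewrite !scale0r addr0 normr0 addr0; apply.
Qed.

Let Sadd x y r s : S x r -> S y s -> S (x + y) (r + s).
Proof.
move=> -[r0 [b Db <-]] [s0 [c Dc <-]]; have rs0 := addr_gt0 r0 s0.
split=> //; exists ((r / (r + s)) *: b + (s / (r + s)) *: c).
  have [_] := bdisk_absconvex B; apply=> //.
  by rewrite !gtr0_norm ?divr_gt0// -mulrDl divff// gt_eqF.
by rewrite scalerDr !scalerA !(mulrC (r + s)) !divfK// gt_eqF.
Qed.

Let Sscale a x r : a != 0 -> S x r -> S (a *: x) (`|a| * r).
Proof.
move=> a0 -[r0 [b Db <-]]; split; first by rewrite mulr_gt0 ?normr_gt0.
exists ((a / `|a|) *: b + 0 *: b).
  have [_] := bdisk_absconvex B; apply=> //.
  by rewrite normrM normfV normr_id divff ?normr_eq0// normr0 addr0.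
rewrite scale0r addr0 !scalerA; congr (_ *: _).
by rewrite mulrAC mulrCA divff ?normr_eq0// mulr1.
Qed.

Let S0 r : 0 < r -> S 0 r.
Proof. by move=> r0; split=> //; exists 0 => //; rewrite scaler0. Qed.

Let Sspan x : x \in EB_pred B -> S x !=set0.
Proof.
move=> /set_mem /(_ [set x | S x !=set0]); apply; split.
  split; first by apply/mem_set; exists 1; exact: S0.
  move=> a y z /set_mem[r Sr] /set_mem[s Ss]; apply/mem_set => /=.
  have [->|a0] := eqVneq a 0; first by exists s; rewrite scale0r add0r.
  by exists (`|a| * r + s); apply: Sadd => //; exact: Sscale.
by move=> y Dy; exists 1; split=> //; exists y => //; rewrite scale1r.
Qed.

Let Sinf x : x \in EB_pred B -> has_inf (S x).
Proof. by move=> /Sspan Sx; split=> //; exists 0 => r [/ltW]. Qed.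

Let mink_lb x r : S x r -> minkowski D x <= r.
Proof. by move=> Sr; apply: ge_inf => //; exists 0 => s [/ltW]. Qed.

Let mink_ge x m : x \in EB_pred B -> (forall r, S x r -> m <= r) ->
  m <= minkowski D x.
Proof. by move=> xB mS; apply: lb_le_inf => //; exact: Sspan. Qed.

Let mink0 : minkowski D 0 = 0.
Proof.
apply/eqP; rewrite eq_le; apply/andP; split; last first.
  by apply: mink_ge => [|r [/ltW]//]; exact: rpred0.
by apply/ler_addgt0Pl => e e0; rewrite addr0 mink_lb//; exact: S0.
Qed.

Let norm (x : EB B) := minkowski D (EB_incl x).

Let ler_normD (x y : EB B) : norm (x + y) <= norm x + norm y.
Proof.
rewrite -lerBlDr; apply: (@mink_ge (EB_incl x) _ (EB_inclP x)) => r Sr.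
rewrite lerBlDr -lerBlDl.
apply: (@mink_ge (EB_incl y) _ (EB_inclP y)) => s Ss.
by rewrite lerBlDl; apply: mink_lb; exact: Sadd.
Qed.

Let normZ (a : R) (x : EB B) : norm (a *: x) = `|a| * norm x.
Proof.
have [->|a0] := eqVneq a 0.
  by rewrite scale0r normr0 mul0r; exact: mink0.
have le b (y : EB B) : b != 0 -> norm (b *: y) <= `|b| * norm y.
  move=> b0; rewrite -ler_pdivrMl ?normr_gt0//.
  apply: (@mink_ge (EB_incl y) _ (EB_inclP y)) => r Sr.
  rewrite ler_pdivrMl ?normr_gt0//; apply: mink_lb; exact: Sscale.
apply/eqP; rewrite eq_le le// andTb.
have := le a^-1 (a *: x); rewrite invr_eq0 => /(_ a0).
by rewrite scalerA mulVf// scale1r normfV ler_pdivlMl ?normr_gt0.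
Qed.

Let norm_eq0 (x : EB B) : norm x = 0 -> x = 0.
Proof.
move=> x0; apply/val_inj/(@convenient_hausdorff R E) => /= N P Nx P0.
exists (EB_incl x); split; first exact: nbhs_singleton.
have := @scale_continuous R E (0, 0) P; rewrite /= scale0r => /(_ P0).
move=> [[V W]/= [/nbhs_ballP[e /= e0 eV] W0] VWP].
have [_ /(_ W W0)[t t0 DW]] := bdisk_bounded B.
have : exists2 r, S (EB_incl x) r & r < e / t.
  apply/not_exists2P => H.
  have : e / t <= norm x.
    apply: (@mink_ge (EB_incl x) _ (EB_inclP x)) => r Sr.
    by case: (H r) => // /negP; rewrite -leNgt.
  by rewrite x0 leNgt divr_gt0.
move=> [r [r0 [b Db <-]] ret].
have [w Ww <-] := DW b Db.
rewrite scalerA; apply: (VWP (r * t, w)); split=> //=.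
apply: eV; rewrite /ball/= sub0r normrN gtr0_norm ?mulr_gt0//.
by rewrite -ltr_pdivlMr.
Qed.

HB.instance Definition _ := @Lmodule_isNormed.Build R (EB B)
  norm ler_normD normZ norm_eq0.

End EB_normed.

Section CM.
Context {R : realType} {F G : convenientType R} (M : nat -> R) (b : flavour).
Variable U : set F.

Definition trace (B : bdisk F) : set (EB B) := [set x | U (EB_incl x)].
Arguments trace B : clear implicits.

Definition trace_incl (B : bdisk F) (x : trace B) : U :=
  exist _ (EB_incl (val x)) (mem_set (set_mem (valP x) : U _)).

Definition CM : lcs (U -> G) :=
  lcs_initial (@smooth_map R F G U)
    [set i : {linear G -> R^o} * bdisk F | continuous i.1]
    (fun i (f : U -> G) (x : trace i.2) => i.1 (f (trace_incl x)) : R^o)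
    (fun i => @CM_open R (EB i.2) R^o M (trace i.2) b).

End CM.
Arguments CM {R F} G M b U.

(* Main.v *)
(** Write [B] for the disk hull of a bounded set [A] of [E]; Mackey completeness
    makes its span a Banach space, so that Baire's argument applies to linear
    functionals bounded on [B].  If all [ev_x \o T] are bounded, the functional
    [e |-> d^k (l \o T e \o i_D) (x) (v)] is bounded on [B], by induction on [k]
    and Banach-Steinhaus: it is a limit of difference quotients of functionals
    of order [k - 1] along a line, and lines are smooth curves, so they stay in
    [U] for a short time.  The norm [jnorm_rho] is a supremum of such
    functionals; by Baire, finiteness of the norms of all [T e] (for one [rho],
    or for some [rho = n + 1] depending on [e]) yields a uniform bound on [B] for
    one [rho].  Conversely, boundedness in [C^[M]] gives boundedness of
    [l (T a x)] for every continuous functional [l], and Mackey's theorem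
    (Hahn-Banach, and the same Baire argument in the dual) concludes. *)
Require Import Defs.
From HB Require Import structures.
From mathcomp Require Import all_boot all_order all_algebra.
From mathcomp Require Import all_classical all_reals all_analysis.
From mathcomp Require Import lra.

Set Implicit Arguments.
Unset Strict Implicit.
Unset Printing Implicit Defensive.

Import Order.TTheory GRing.Theory Num.Theory.
Import numFieldNormedType.Exports.

Local Open Scope classical_set_scope.
Local Open Scope ring_scope.

(** * Uniform boundedness on complete disks *)

Section disks.
Context {R : realType} {V : lmodType R}.
Implicit Types (B : set V) (f : V -> R).

(* Completeness of the space spanned by B and normed by its Minkowski
   functional, for rapidly converging sequences. *)
Definition complete_disk B := forall (x : nat -> V) (r : nat -> R),
  x 0 = 0 -> (forall n, 0 < r n) -> (forall n, r n.+1 <= r n / 2) ->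
  (forall n, exists2 b, B b & x n.+1 - x n = (r n / 2) *: b) ->
  exists l, forall n, exists2 b, B b & l - x n = r n *: b.

Definition disk_functional B f :=
  scalar f /\ exists c : R, forall b, B b -> `|f b| <= c.

Lemma scalar_fun0 f : scalar f -> f 0 = 0.
Proof. by move=> fl; have := fl (-1) 0 0; rewrite scaler0 addr0; lra. Qed.

Lemma scalar_funZ f a x : scalar f -> f (a *: x) = a * f x.
Proof.
by move=> fl; have := fl a x 0; rewrite addr0 (scalar_fun0 fl) addr0.
Qed.

Lemma scalar_funD f x y : scalar f -> f (x + y) = f x + f y.
Proof. by move=> fl; have := fl 1 x y; rewrite scale1r mul1r. Qed.

Lemma absconvex0 B : absconvex B -> B 0.
Proof.
move=> [[x Bx] /(_ 0 0 x x)].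
by rewrite !scale0r addr0 normr0 addr0; exact.
Qed.

Lemma absconvexZ B a x : absconvex B -> `|a| <= 1 -> B x -> B (a *: x).
Proof.
move=> [_ cB] a1 Bx; have := cB a 0 x x; rewrite scale0r addr0 normr0 addr0.
exact.
Qed.

(** For [w] a multiple of a point of the disk where [f] is large, [f (y + w)] and [f (y - w)] differ
    by [2 * f w]. So one of them exceeds [n] in absolute value, and this persists on a small disk
    because [f] is bounded on [B]. *)
Lemma disk_escape B (Phi : set (V -> R)) (n : R) (y : V) (r : R) :
  absconvex B -> Phi `<=` disk_functional B ->
  (forall c, exists2 f, Phi f & exists2 x, B x & c < `|f x|) -> 0 < r ->
  exists z : V * R, [/\ exists2 b, B b & z.1 - y = (r / 2) *: b, 0 < z.2,
    z.2 <= r / 2 & forall b, B b -> exists2 f, Phi f &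
      n < `|f (z.1 + z.2 *: b)|].
Proof.
move=> aB PhiB unb r0; have [f Pf [x Bx fx]] := unb (n / (r / 2)).
have [fl [c fc]] := PhiB _ Pf.
have r20 : 0 < r / 2 by rewrite divr_gt0.
have nfu : n < `|f ((r / 2) *: x)|.
  by rewrite scalar_funZ// normrM gtr0_norm// mulrC -ltr_pdivrMr.
have [s [s1 ns]] : exists s : R, `|s| <= 1 /\ n < `|f (y + (r / 2) *: (s *: x))|.
  have [H|H] := ltP n `|f (y + (r / 2) *: (1 *: x))|; first by exists 1; rewrite normr1.
  exists (- 1); rewrite normrN normr1; split=> //.
  apply: (lt_le_trans nfu); move: H nfu; rewrite scale1r scaleN1r scalerN.
  rewrite -scaleNr !(scalar_funD _ _ fl) !(scalar_funZ _ _ fl) mulNr.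
  move: (f y) (r / 2 * f x) => u w.
  have := ler_normB (u + w) (u - w).
  have -> : u + w - (u - w) = w *+ 2 by rewrite opprB addrCA addrAC subrr add0r mulr2n.
  by rewrite normrMn mulr2n; lra.
set z := y + (r / 2) *: (s *: x) in ns.
have c0 : 0 <= c by rewrite (le_trans _ (fc x Bx)).
(* Within radius [t] the value of [f] moves by less than the excess of [f z] over [n]; the summand 1
   keeps the denominator positive. *)
pose t := Num.min (r / 2) ((`|f z| - n) / (c + 1)).
have t0 : 0 < t by rewrite lt_min r20 divr_gt0 ?subr_gt0// ltr_wpDl.
exists (z, t); split => //=.
- by exists (s *: x); [exact: absconvexZ|rewrite /z addrAC subrr add0r].
- by rewrite ge_min lexx.
move=> b Bb; exists f => //.
rewrite scalar_funD// scalar_funZ//.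
have tc : t * `|f b| < `|f z| - n.
  apply: (@le_lt_trans _ _ (t * c)); first by rewrite ler_wpM2l ?fc// ltW.
  apply: (@lt_le_trans _ _ (t * (c + 1))); first by rewrite ltr_pM2l// ltrDl.
  by rewrite -ler_pdivlMr ?ltr_wpDl// ge_min lexx orbT.
have := lerB_normD (f z) (t * f b); rewrite normrM (gtr0_norm t0).
by move: tc; lra.
Qed.

(* Baire's theorem for the sets [set x | forall f, Phi n f -> `|f x| <= n]. *)
Lemma disk_uniform_boundedness B (Phi : nat -> set (V -> R)) :
  absconvex B -> complete_disk B ->
  (forall n, Phi n `<=` disk_functional B) ->
  (forall x, B x -> exists n, forall f, Phi n f -> `|f x| <= n%:R) ->
  exists n (c : R), forall f, Phi n f -> forall x, B x -> `|f x| <= c.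
Proof.
move=> aB cB PhiB ptb; apply/not_existsP => unb.
have {}unb n c : exists2 f, Phi n f & exists2 x, B x & c < `|f x|.
  apply: contrapT => nH; apply: (unb n); exists c => f Pf x Bx.
  by rewrite leNgt; apply/negP => H; apply: nH; exists f => //; exists x.
(* The guard [0 < z.2] makes [good] satisfiable from every pair, so choice gives a total [next]. *)
pose good (n : nat) (z z' : V * R) := 0 < z.2 ->
  [/\ exists2 b, B b & z'.1 - z.1 = (z.2 / 2) *: b, 0 < z'.2,
    z'.2 <= z.2 / 2 & forall b, B b -> exists2 f, Phi n f &
      n%:R < `|f (z'.1 + z'.2 *: b)|].
have /choice[next nextP] (nz : nat * (V * R)) : exists z', good nz.1 nz.2 z'.
  case: nz => n [y r] /=; have [r0|r0] := ltP 0 r; last first.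
    by exists (y, r); rewrite /good /= => /lt_le_trans/(_ r0); rewrite ltxx.
  have [z' H] := disk_escape n%:R y aB (PhiB n) (unb n) r0.
  by exists z'.
pose z := fix z n := if n is m.+1 then next (m, z m) else (0, 1).
have z0 n : 0 < (z n).2.
  by elim: n => //= n IH; have [] := nextP (n, z n) IH.
have zS n : [/\ exists2 b, B b & (z n.+1).1 - (z n).1 = ((z n).2 / 2) *: b,
    0 < (z n.+1).2, (z n.+1).2 <= (z n).2 / 2 &
    forall b, B b -> exists2 f, Phi n f &
      n%:R < `|f ((z n.+1).1 + (z n.+1).2 *: b)|].
  exact: (nextP (n, z n) (z0 n)).
have [l lz] := cB (fun n => (z n).1) (fun n => (z n).2) erefl z0
  (fun n => let: And4 _ _ H _ := zS n in H) (fun n => let: And4 H _ _ _ := zS n in H).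
(* The first disk is [B] itself, with centre 0 and radius 1. *)
have Bl : B l by have [b Bb] := lz 0; rewrite /= subr0 scale1r => ->.
have [n ln] := ptb l Bl.
(* The limit also lies in the disk of stage [n.+1], at each point of which some member of [Phi n]
   exceeds [n]. *)
have [b Bb /eqP] := lz n.+1; rewrite subr_eq addrC => /eqP lE.
have [_ _ _ /(_ b Bb)[f Pf]] := zS n; rewrite -lE ltNge.
by rewrite ln.
Qed.

(* Banach-Steinhaus *)
Lemma disk_functional_cvg B (f : nat -> V -> R) (g : V -> R) :
  absconvex B -> complete_disk B -> (forall n, disk_functional B (f n)) ->
  (forall x, f n x @[n --> \oo] --> g x) -> disk_functional B g.
Proof.
move=> aB cB fB fg; split.
  move=> a x y; have H : f n (a *: x + y) @[n --> \oo] --> a * g x + g y.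
    have -> : f ^~ (a *: x + y) = fun n => a * f n x + f n y.
      by apply/funext => n; exact: (fB n).1.
    by apply: cvgD; [apply: cvgM; [exact: cvg_cst|exact: fg]|exact: fg].
  exact: (cvg_unique _ (fg _) H).
have [||n [c bc]] := @disk_uniform_boundedness B (fun=> range f) aB cB.
- by move=> _ _ [m _ <-]; exact: fB.
- move=> x Bx; have /cvg_seq_bounded/pinfty_ex_gt0[c c0 /= fc] : cvgn (f ^~ x).
    by apply/cvg_ex; exists (g x).
  exists (Num.bound c) => _ [m _ <-]; rewrite (le_trans (fc m _))//.
  exact/ltW/archi_boundP/ltW.
exists c => x Bx.
have H : `|f m x| @[m --> \oo] --> `|g x| by exact: cvg_norm.
apply: (cvgr_to_le H).
by near=> m; apply: bc => //; exists m.
Unshelve. all: by end_near. Qed.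
End disks.

(** * Hahn-Banach *)

Section hahn_banach.
Context {R : realType} {V : lmodType R}.

Definition seminorm (p : V -> R) :=
  (forall x y, p (x + y) <= p x + p y) /\ (forall a x, p (a *: x) = `|a| * p x).

Lemma seminorm0 p : seminorm p -> p 0 = 0.
Proof. by move=> [_ /(_ 0 0)]; rewrite scale0r normr0 mul0r. Qed.

Lemma seminormN p x : seminorm p -> p (- x) = p x.
Proof. by move=> [_ pZ]; rewrite -scaleN1r pZ normrN normr1 mul1r. Qed.

Lemma seminorm_ge0 p x : seminorm p -> 0 <= p x.
Proof.
move=> sp; have := sp.1 x (- x).
by rewrite subrr seminorm0// seminormN//; lra.
Qed.

(* The graph of a linear functional on a subspace; domination by p makes it
   single-valued. *)
Definition dominated_graph (p : V -> R) (G : set (V * R)) :=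
  (forall a u v, G u -> G v -> G (a *: u.1 + v.1, a * u.2 + v.2)) /\
  (forall u, G u -> u.2 <= p u.1).

(** The value at [x0] must lie above all [u.2 - p (u.1 - x0)] and below all [p (v.1 + x0) - v.2].
    Subadditivity of [p] makes this interval nonempty, and [al] is its lower end. *)
Lemma dominated_graph_extend p (G : set (V * R)) (x0 : V) :
  seminorm p -> G (0, 0) -> dominated_graph p G ->
  exists G', [/\ dominated_graph p G', G `<=` G' & exists a, G' (x0, a)].
Proof.
move=> sp G0 [Gl Gp]; have [pD pZ] := sp.
pose S := [set u.2 - p (u.1 - x0) | u in G].
have Sub u v : G u -> G v -> u.2 - p (u.1 - x0) <= p (v.1 + x0) - v.2.
  move=> Gu Gv; have := Gp _ (Gl 1 u v Gu Gv); rewrite /= scale1r mul1r.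
  have := pD (u.1 - x0) (v.1 + x0); rewrite addrACA addNr addr0; lra.
have Ss : has_sup S.
  split; first by exists (0 - p (0 - x0)), (0, 0).
  by exists (p (0 + x0) - 0) => _ [u Gu <-]; exact: (Sub u (0, 0)).
pose al := sup S.
have alge u : G u -> u.2 - p (u.1 - x0) <= al.
  by move=> Gu; apply: ub_le_sup; [exact: Ss.2|exists u].
have alle v : G v -> al <= p (v.1 + x0) - v.2.
  move=> Gv; apply: sup_le_ub; first exact: Ss.1.
  by move=> _ [u Gu <-]; exact: Sub.
have GZ a u : G u -> G (a *: u.1, a * u.2).
  by move=> Gu; have := Gl a u (0, 0) Gu G0; rewrite /= !addr0.
exists [set w | exists t, G (w.1 - t *: x0, w.2 - t * al)]; split; first split.
- move=> a u v [t Gt] [s Gs]; exists (a * t + s) => /=.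
  have := Gl a _ _ Gt Gs; rewrite /= scalerBr mulrBr scalerDl mulrDl !opprD.
  by rewrite scalerA mulrA [in X in G X -> _]addrACA [in X in G (_, X) -> _]addrACA.
(* Dividing by the absolute value of [t] reduces domination to the coefficients -1 and 1 of [x0],
   where the two bounds on [al] apply. *)
- move=> [x c] [t /=]; have [t0|t0|->] := ltgtP t 0.
  + move=> /(GZ (- t)^-1)/alge /=.
    have t0' : 0 < - t by rewrite oppr_gt0.
    have -> : (- t)^-1 *: (x - t *: x0) - x0 = (- t)^-1 *: x.
      by rewrite scalerBr scalerA invrN mulNr mulVf ?lt_eqF// scaleN1r opprK addrK.
    rewrite pZ gtr0_norm ?invr_gt0//.
    by rewrite -mulrBr ler_pdivrMl//; lra.
  + move=> /(GZ t^-1)/alle /=.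
    have -> : t^-1 *: (x - t *: x0) + x0 = t^-1 *: x.
      by rewrite scalerBr scalerA mulVf ?gt_eqF// scale1r subrK.
    by rewrite pZ gtr0_norm ?invr_gt0// -mulrBr ler_pdivlMl//; lra.
  + by rewrite scale0r mul0r !subr0 => /Gp.
- by move=> [x c] Gxc; exists 0; rewrite scale0r mul0r !subr0.
- by exists al, 1; rewrite scale1r mul1r !subrr.
Qed.

Lemma hahn_banach (p : V -> R) (v : V) : seminorm p ->
  exists f : V -> R, [/\ scalar f, forall x, `|f x| <= p x & f v = p v].
Proof.
move=> sp; pose L := [set (t *: v, t * p v) | t in [set: R]].
have L0 : L (0, 0) by exists 0; rewrite // scale0r mul0r.
have Lp : dominated_graph p L.
  split=> [a _ _ [t _ <-] [s _ <-]|_ [t _ <-]] /=.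
    by exists (a * t + s); rewrite // scalerDl mulrDl scalerA mulrA.
  by rewrite sp.2 ler_wpM2r ?ler_norm// seminorm_ge0.
(* [L] is joined to [A] in the predicate so that the union of the empty chain satisfies it too. *)
have [C|A [PA Amax]] := @Zorn_bigcup _ [set A | dominated_graph p (A `|` L)].
  move=> CP Ctot; split; last first.
    move=> u [[X CX Xu]|Lu]; last exact: Lp.2.
    by apply: (CP X CX).2; left.
  have in1 X u w : C X -> (X `|` L) u -> (X `|` L) w -> forall a,
      (\bigcup_(X in C) X `|` L) (a *: u.1 + w.1, a * u.2 + w.2).
    move=> CX Xu Xw a; have [Y|] := (CP X CX).1 a u w Xu Xw; last by right.
    by left; exists X.
  move=> a u w [[X CX Xu]|Lu] [[Y CY Yw]|Lw].
  - have [XY|YX] := Ctot X Y CX CY.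
      by apply: (in1 Y) => //; left => //; exact: XY.
    by apply: (in1 X) => //; left => //; exact: YX.
  - by apply: (in1 X) => //; [left|right].
  - by apply: (in1 Y) => //; [right|left].
  - by right; exact: Lp.1.
have G0 : (A `|` L) (0, 0) by right.
have total x : exists a, (A `|` L) (x, a).
  have [G' [G'p AG' [a G'a]]] := dominated_graph_extend x sp G0 PA.
  apply: contrapT => na; apply: (Amax G').
    split; first by move=> u Au; apply: AG'; left.
    by move=> G'A; apply: na; exists a; left; exact: G'A.
  rewrite /=; suff -> : G' `|` L = G' by [].
  by apply/setUidl => u Lu; apply: AG'; right.
have /choice[f fP] := total.
(* Two values at one point put their difference over 0 into the graph, where [p 0 = 0] bounds it. *)
have uniq x a c : (A `|` L) (x, a) -> (A `|` L) (x, c) -> a <= c.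
  move=> Ha Hc; have := PA.1 (-1) _ _ Hc Ha; rewrite /= scaleN1r addNr.
  by move=> /PA.2 /=; rewrite seminorm0//; lra.
have {}uniq x a : (A `|` L) (x, a) -> f x = a.
  by move=> Ha; apply/eqP; rewrite eq_le !(uniq x)//; exact: fP.
have fl : scalar f by move=> a x y; apply: uniq; exact: (PA.1 a _ _ (fP x) (fP y)).
exists f; split=> //.
  move=> x; rewrite ler_norml lerNl; apply/andP; split; last exact: PA.2 (fP x).
  have := PA.2 _ (fP (- x)); rewrite /= (seminormN _ sp).
  by rewrite -(scaleN1r x) (scalar_funZ _ _ fl) mulN1r.
by apply: uniq; right; exists 1; rewrite // scale1r mul1r.
Qed.

End hahn_banach.

(** * Seminorms and bounded sets of locally convex spaces *)

Section gauge.
Context {R : realType} {V : lmodType R} (W : set V).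
Hypotheses (aW : absconvex W).
Hypothesis absorbW : forall x, exists2 r : R, 0 < r & [set r *: w | w in W] x.

Let S x := [set r | 0 < r /\ [set r *: w | w in W] x].

Lemma minkowski_le x r : 0 < r -> [set r *: w | w in W] x -> Defs.minkowski W x <= r.
Proof. by move=> r0 Wx; apply: ge_inf => //; exists 0 => s [/ltW]. Qed.

Let minkowski_ge x m : (forall r, S x r -> m <= r) -> m <= Defs.minkowski W x.
Proof.
move=> mS; apply: lb_le_inf => //.
by have [r r0 rx] := absorbW x; exists r.
Qed.

Lemma minkowski_seminorm : seminorm (Defs.minkowski W).
Proof.
have pD x y : Defs.minkowski W (x + y) <= Defs.minkowski W x + Defs.minkowski W y.
  rewrite -lerBlDr; apply: minkowski_ge => r [r0 [u Wu <-]].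
  rewrite lerBlDr -lerBlDl; apply: minkowski_ge => s [s0 [v Wv <-]].
  have rs0 := addr_gt0 r0 s0; have rsn0 := gt_eqF rs0.
  rewrite lerBlDl; apply: minkowski_le => //.
  exists ((r / (r + s)) *: u + (s / (r + s)) *: v).
    apply: aW.2 => //.
    by rewrite !gtr0_norm ?divr_gt0// -mulrDl divff ?rsn0.
  by rewrite scalerDr !scalerA ![(r + s) * _]mulrC !divfK ?rsn0.
have pZ_le a x : a != 0 -> Defs.minkowski W (a *: x) <= `|a| * Defs.minkowski W x.
  move=> a0; have na0 : 0 < `|a| by rewrite normr_gt0.
  rewrite -ler_pdivrMl//; apply: minkowski_ge => r [r0 [u Wu <-]].
  rewrite ler_pdivrMl//; apply: minkowski_le; first by rewrite mulr_gt0.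
  exists ((a / `|a|) *: u).
    apply: absconvexZ => //.
    by rewrite normrM normfV normr_id divff ?normr_eq0.
  rewrite !scalerA; congr (_ *: _).
  by rewrite mulrAC mulrCA divff ?normr_eq0// mulr1.
split=> // a x; have [->|a0] := eqVneq a 0.
  rewrite scale0r normr0 mul0r; apply/eqP; rewrite eq_le; apply/andP; split.
    apply/ler_addgt0Pl => e e0; rewrite addr0; apply: minkowski_le => //.
    by exists 0; [exact: absconvex0|rewrite scaler0].
  by apply: minkowski_ge => r [/ltW].
apply/eqP; rewrite eq_le pZ_le// andTb.
have := @pZ_le a^-1 (a *: x); rewrite invr_eq0 => /(_ a0).
by rewrite scalerA mulVf// scale1r normfV ler_pdivlMl ?normr_gt0.
Qed.

Lemma minkowski_lt1 x : Defs.minkowski W x < 1 -> W x.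
Proof.
move=> /inf_lt[|r [r0 [w Ww <-]] r1].
  by have [r r0 rx] := absorbW x; exists r.
by apply: absconvexZ => //; rewrite gtr0_norm// ltW.
Qed.

End gauge.

Section tvs.
Context {R : realType} {E : tvsType R}.
Implicit Types (A N : set E) (p : E -> R).

(** A convex basic neighbourhood intersected with its negative is convex, symmetric and contains 0,
    hence is absolutely convex. *)
Lemma nbhs0_absconvex N : nbhs (0 : E) N ->
  exists W, [/\ absconvex W, nbhs (0 : E) W & W `<=` N].
Proof.
move=> N0; have [Bs Bcvx [Bo Bb]] := @locally_convex R E.
have [U [BU U0] UN] := Bb 0 N N0.
have nU : nbhs (0 : E) U by apply: open_nbhs_nbhs; split=> //; exact: Bo.
have Uc x y (t : R) : 0 <= t -> t <= 1 -> U x -> U y -> U (t *: x + (1 - t) *: y).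
  move=> t0 t1 Ux Uy; have := Bcvx U (mem_set BU) x y (Itv01 t0 t1).
  by move=> /(_ (mem_set Ux) (mem_set Uy)) /set_mem.
pose W := [set x | U x /\ U (- x)].
have W0 : W 0 by rewrite /W /= oppr0.
have Wc x y (t : R) : 0 <= t -> t <= 1 -> W x -> W y -> W (t *: x + (1 - t) *: y).
  move=> t0 t1 [Ux Ux'] [Uy Uy']; split; first exact: Uc.
  by rewrite opprD -!scalerN; exact: Uc.
have Ws (a : R) x : W x -> exists2 x', W x' & a *: x = `|a| *: x'.
  move=> [Ux Ux']; have [a0|a0] := leP 0 a; first by exists x; rewrite // ger0_norm.
  by exists (- x); [split; rewrite ?opprK|rewrite ltr0_norm// scalerN scaleNr opprK].
exists W; split.
- split; first by exists 0.
  move=> a b x y ab /(Ws a)[x' Wx' ->] /(Ws b)[y' Wy' ->].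
  have [s0|s0] := eqVneq (`|a| + `|b|) 0.
    move: s0 => /eqP; rewrite paddr_eq0// => /andP[/eqP -> /eqP ->].
    by rewrite !scale0r addr0.
  have {}s0 : 0 < `|a| + `|b| by rewrite lt_def s0 addr_ge0.
  (* [a *: x + b *: y] is [s] times a convex combination of the sign-adjusted points, plus [1 - s]
     times 0. *)
  pose s := `|a| + `|b|.
  have := @Wc _ _ (`|a| / s) (divr_ge0 (normr_ge0 _) (ltW s0)) _ Wx' Wy'.
  rewrite ler_pdivrMr// mul1r lerDl => /(_ (normr_ge0 _)) H.
  have := Wc _ _ s (ltW s0) ab H W0; rewrite scaler0 addr0 scalerDr !scalerA.
  rewrite mulrBr mulr1 [s * (_ / _)]mulrC divfK ?gt_eqF//.
  by rewrite {1}/s [`|a| + _]addrC addrK.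
- apply: filterI => //; have := @opp_continuous E 0 U; rewrite oppr0.
  by move=> /(_ nU).
- by move=> x [/UN].
Qed.

Definition continuous_seminorm p := seminorm p /\ nbhs (0 : E) [set x | p x < 1].

Lemma nbhs0_absorbing N x : nbhs (0 : E) N ->
  exists2 r : R, 0 < r & [set r *: w | w in N] x.
Proof.
move=> N0; have := @scale_continuous R E (0, x) N; rewrite /= scale0r => /(_ N0).
move=> [[P Q]/= [/nbhs_ballP[e /= e0 eP] Qx] PQN].
have e20 : 0 < e / 2 by rewrite divr_gt0.
exists (e / 2)^-1; first by rewrite invr_gt0.
exists ((e / 2) *: x); last by rewrite scalerA mulVf ?gt_eqF// scale1r.
apply: (PQN (e / 2, x)); split=> /=; last exact: nbhs_singleton.
by apply: eP; rewrite /ball/= sub0r normrN gtr0_norm//; lra.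
Qed.

Lemma nbhs0_seminorm N : nbhs (0 : E) N ->
  exists2 p, continuous_seminorm p & [set x | p x < 1] `<=` N.
Proof.
move=> /nbhs0_absconvex[W [aW nW WN]].
have abW x := nbhs0_absorbing x nW.
exists (Defs.minkowski W); last by move=> x /(minkowski_lt1 aW abW)/WN.
split; first exact: minkowski_seminorm.
have h0 : (2^-1 : R) != 0 by rewrite invr_eq0 pnatr_eq0.
apply: filterS (nbhs0Z h0 nW) => _ [w Ww <-] /=.
apply: (@le_lt_trans _ _ 2^-1); last by lra.
by apply: minkowski_le; [lra|exists w].
Qed.

Lemma continuous_seminorm_ball p x e : continuous_seminorm p -> 0 < e ->
  nbhs x [set y | p (y - x) < e].
Proof.
move=> [sp np] e0; have := @nbhsT _ _ _ x (nbhs0Z (lt0r_neq0 e0) np).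
apply: filterS => _ [_ [y py <-] <-] /=.
by rewrite addrAC subrr add0r sp.2 gtr0_norm// -ltr_pdivlMl// mulVf ?gt_eqF.
Qed.

Lemma seminorm_distr p x y : seminorm p -> `|p x - p y| <= p (y - x).
Proof.
move=> sp; have := sp.1 (y - x) x; have := sp.1 (x - y) y.
rewrite !subrK -(opprB y x) seminormN// ler_norml => H1 H2.
by apply/andP; split; lra.
Qed.

Lemma continuous_seminorm_continuous p : continuous_seminorm p -> continuous p.
Proof.
move=> cp x; apply/cvgrPdist_lt => e e0.
apply: filterS (continuous_seminorm_ball x cp e0) => y /=.
by apply: le_lt_trans; exact: seminorm_distr cp.1.
Qed.

Lemma continuous_seminormZ p c : 0 < c -> continuous_seminorm p ->
  continuous_seminorm (fun x => c * p x).
Proof.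
move=> c0 cp; split.
  split=> [x y|a x]; first by rewrite -mulrDr ler_pM2l//; exact: cp.1.1.
  by rewrite cp.1.2 mulrCA.
have ci0 : 0 < c^-1 by rewrite invr_gt0.
have := continuous_seminorm_ball 0 cp ci0; apply: filterS => x /=.
by rewrite subr0 -(ltr_pM2l c0) divff ?gt_eqF.
Qed.

Lemma normr_continuous_seminorm (l : {linear E -> R^o}) : continuous l ->
  continuous_seminorm (fun x => `|l x|).
Proof.
move=> cl; split.
  split=> [x y|a x]; first by rewrite linearD; exact: ler_normD.
  by rewrite linearZ /=; exact: normrM.
have /cvgrPdist_lt/(_ 1 ltr01) := cl 0.
by apply: filterS => x /=; rewrite linear0 sub0r normrN.
Qed.

Lemma bounded_seminorm A p : lcs_bounded (lcs_of_tvs E) A ->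
  continuous_seminorm p -> exists2 c, 0 < c & forall a, A a -> p a <= c.
Proof.
move=> [_ bA] cp; have [r r0 Ar] := bA _ cp.2.
exists r => // a /Ar[x /= px <-].
by rewrite cp.1.2 gtr0_norm// ger_pMr// ltW.
Qed.

Lemma seminorm_bounded A :
  (forall p, continuous_seminorm p -> exists c, forall a, A a -> p a <= c) ->
  lcs_bounded (lcs_of_tvs E) A.
Proof.
move=> bA; split=> // N /nbhs0_seminorm[p cp pN]; have [c Ac] := bA p cp.
have d0 : 0 < `|c| + 1 by rewrite ltr_wpDl.
exists (`|c| + 1) => // a Aa; exists ((`|c| + 1)^-1 *: a).
  apply: pN; rewrite /= cp.1.2 gtr0_norm ?invr_gt0// ltr_pdivrMl// mulr1.
  by rewrite (le_lt_trans (Ac a Aa))// (le_lt_trans (ler_norm c))// ltrDl.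
by rewrite scalerA divff ?gt_eqF// scale1r.
Qed.

(* The bipolar of A, described by seminorms. *)
Definition disk_hull A : set E := [set x | forall p, continuous_seminorm p ->
  (forall a, A a -> p a <= 1) -> p x <= 1].

Lemma sub_disk_hull A : A `<=` disk_hull A.
Proof. by move=> x Ax p _; exact. Qed.

Lemma disk_hull_absconvex A : absconvex (disk_hull A).
Proof.
split; first by exists 0 => p cp _; rewrite (seminorm0 cp.1).
move=> a b x y ab Ax Ay p cp Ap; rewrite (le_trans (cp.1.1 _ _))// !cp.1.2.
rewrite (le_trans _ ab)// lerD//.
  by rewrite ler_piMr//; exact: Ax.
by rewrite ler_piMr//; exact: Ay.
Qed.

Lemma disk_hull_closed A : closed (disk_hull A).
Proof.
have -> : disk_hull A = \bigcap_(p in [set p | continuous_seminorm p /\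
    forall a, A a -> p a <= 1]) (p @^-1` [set y | y <= 1]).
  by apply/seteqP; split=> [x Hx p [cp Ap]|x Hx p cp Ap]; exact: Hx.
apply: closed_bigI => p [cp _]; apply: closed_comp; last exact: closed_le.
by move=> x _; exact: continuous_seminorm_continuous.
Qed.

Lemma disk_hull_bounded A : lcs_bounded (lcs_of_tvs E) A ->
  lcs_bounded (lcs_of_tvs E) (disk_hull A).
Proof.
move=> bA; apply: seminorm_bounded => p cp.
have [c c0 Ac] := bounded_seminorm bA cp.
exists c => x Hx; have ci0 : 0 < c^-1 by rewrite invr_gt0.
have := Hx _ (continuous_seminormZ ci0 cp); rewrite ler_pdivrMl// mulr1; apply.
by move=> a Aa; rewrite ler_pdivrMl// mulr1 Ac.
Qed.

Lemma disk_hull_scale A r z : 0 < r ->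
  (forall p, continuous_seminorm p -> (forall a, A a -> p a <= 1) -> p z <= r) ->
  exists2 b, disk_hull A b & z = r *: b.
Proof.
move=> r0 Hz; exists (r^-1 *: z); last by rewrite scalerA divff ?gt_eqF// scale1r.
move=> p cp Ap; rewrite cp.1.2 gtr0_norm ?invr_gt0//.
by rewrite ler_pdivrMl// mulr1 Hz.
Qed.

End tvs.

(** * Completeness of hulls and Mackey's theorem *)

Section halving.
Context {R : realType} (r : nat -> R).
Hypotheses (r0 : forall n, 0 < r n) (rS : forall n, r n.+1 <= r n / 2).

Lemma halving_cvg0 : r n @[n --> \oo] --> (0 : R).
Proof.
have rle n : r n <= geometric (r 0) 2^-1 n.
  elim: n => [|n IH]; first by rewrite /geometric /= expr0 mulr1.
  rewrite (le_trans (rS n))// /geometric /= exprSr mulrA ler_pM2r//.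

apply: (squeeze_cvgr (f := cst 0) (h := geometric (r 0) 2^-1)).
- by near=> n; rewrite (ltW (r0 n)) rle.
- exact: cvg_cst.
- by apply: cvg_geometric; rewrite gtr0_norm//; lra.
Unshelve. all: by end_near. Qed.

Lemma halving_le0 (c C : R) : (forall n, c <= C * r n) -> c <= 0.
Proof.
move=> H; have : C * r n @[n --> \oo] --> C * 0.
  by apply: cvgM; [exact: cvg_cst|exact: halving_cvg0].
rewrite mulr0 => /cvgr_to_ge; apply; near=> n; exact: H.
Unshelve. all: by end_near. Qed.

(** From [r k.+1 <= r k / 2] follows [r k / 2 <= r k - r k.+1], so the bounds on the increments
    telescope. *)
Lemma halving_telescope (V : lmodType R) (p : V -> R) (x : nat -> V) :
  seminorm p -> (forall n, p (x n.+1 - x n) <= r n / 2) ->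
  forall n k, p (x (n + k)%N - x n) <= r n - r (n + k)%N.
Proof.
move=> sp xS n; elim=> [|k IH]; first by rewrite addn0 !subrr seminorm0.
rewrite addnS.
have -> : x (n + k).+1 - x n = (x (n + k).+1 - x (n + k)%N) + (x (n + k)%N - x n).
  by rewrite addrA subrK.
rewrite (le_trans (sp.1 _ _))//; have := xS (n + k)%N; have := rS (n + k)%N.
by move: IH; lra.
Qed.

End halving.

(** Continuous seminorms test membership in multiples of the hull. They show the sequence to be
    Mackey-Cauchy, so it converges in [E], and their inequalities pass to the limit. *)
Lemma disk_hull_complete (R : realType) (E : convenientType R) (A : set E) :
  lcs_bounded (lcs_of_tvs E) A -> complete_disk (disk_hull A).
Proof.
move=> bA x r _ r0 rS xS.
have tel p : continuous_seminorm p -> (forall a, A a -> p a <= 1) ->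
    forall n m, (n <= m)%N -> p (x m - x n) <= r n.
  move=> cp Ap n m nm; have H k : p (x k.+1 - x k) <= r k / 2.
    have [b Bb ->] := xS k; rewrite cp.1.2 gtr0_norm ?divr_gt0//.
    by rewrite ler_piMr ?divr_ge0 ?(ltW (r0 k))//; exact: Bb.
  have := halving_telescope rS cp.1 H n (m - n); rewrite subnKC//.
  by have := r0 m; lra.
have [|l xl] := @convenient_complete R E x.
  exists (disk_hull A); split.
  - exact: disk_hull_bounded.
  - exact: disk_hull_absconvex.
  (* The [r] of the smaller index controls the difference of two terms; the sum covers both
     orders. *)
  exists (fun nm => r nm.1 + r nm.2).
    rewrite -[X in _ --> X](addr0 0); apply: cvgD.
      by apply: cvg_comp; [exact: cvg_fst|exact: halving_cvg0].
    by apply: cvg_comp; [exact: cvg_snd|exact: halving_cvg0].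
  move=> n m; have [||b Bb ->] := @disk_hull_scale _ _ A (r n + r m) (x n - x m).
  - by rewrite addr_gt0.
  - move=> p cp Ap; have [nm|/ltnW nm] := leqP n m.
      rewrite -opprB (seminormN _ cp.1).
      by have := tel p cp Ap _ _ nm; have := r0 m; lra.
    by have := tel p cp Ap _ _ nm; have := r0 n; lra.
  - by exists b.
exists l => n; apply: disk_hull_scale => // p cp Ap.
apply/ler_addgt0Pl => e e0.
have /xl[m _ mP] := continuous_seminorm_ball l cp e0.
have [nN mN] : (n <= maxn n m)%N /\ (m <= maxn n m)%N by rewrite leq_maxl leq_maxr.
have -> : l - x n = - (x (maxn n m) - l) + (x (maxn n m) - x n).
  by rewrite opprB addrA subrK.
rewrite (le_trans (cp.1.1 _ _))// (seminormN _ cp.1) lerD//.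
  exact: ltW (mP _ mN).
exact: tel.
Qed.

(* Mackey's theorem; uniform boundedness is applied to the polar of the unit
   ball of a continuous seminorm. *)
Lemma weakly_bounded (R : realType) (E : tvsType R) (A : set E) :
  (forall l : {linear E -> R^o}, continuous l ->
    exists c : R, forall a, A a -> `|l a| <= c) ->
  lcs_bounded (lcs_of_tvs E) A.
Proof.
move=> wA; apply: seminorm_bounded => p cp; have sp := cp.1.
pose B := [set f : E -> R^o | scalar f /\ forall x, `|f x| <= p x].
have aB : absconvex B.
  split.
    exists (fun=> 0); split=> [a x y|x]; first by rewrite mulr0 addr0.
    by rewrite normr0 seminorm_ge0.
  move=> a b f g ab [fl fp] [gl gp]; split.
    move=> c x y; rewrite -![(_ + _) _]/(a * f _ + b * g _) fl gl; lra.
  move=> x; rewrite -![(_ + _) _]/(a * f x + b * g x).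
  rewrite (le_trans (ler_normD _ _))// !normrM.
  rewrite (@le_trans _ _ ((`|a| + `|b|) * p x))//.
    by rewrite mulrDl lerD// ler_wpM2l.
  by rewrite ler_piMl// seminorm_ge0.
have cB : complete_disk B.
  move=> x r x0 r0 rS xS.
  have xl n : scalar (x n).
    elim: n => [|n IH] a u v; first by rewrite x0 mulr0 addr0.
    have [b [bl _] /eqP] := xS n; rewrite subr_eq => /eqP ->.
    rewrite -![(_ + _) _]/(r n / 2 * b _ + x n _) bl IH; lra.
  have xSp n y : `|x n.+1 y - x n y| <= r n / 2 * p y.
    have [b [_ bp] H] := xS n.
    have -> : x n.+1 y - x n y = r n / 2 * b y by rewrite -[LHS]/((x n.+1 - x n) y) H.
    by rewrite normrM gtr0_norm ?divr_gt0// ler_pM2l ?divr_gt0.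
  have tel y n k : `|x (n + k)%N y - x n y| <= r n * p y - r (n + k)%N * p y.
    have rpS m : r m.+1 * p y <= r m * p y / 2.
      by rewrite mulrAC ler_wpM2r ?seminorm_ge0.
    apply: (@halving_telescope _ _ rpS (E -> R^o) (fun f => `|f y|)).
      by split=> [f g|a f]; [exact: ler_normD|exact: normrM].
    by move=> m; rewrite mulrAC; exact: xSp.
  have lo y n m : x n y - r n * p y <= x m y + r m * p y.
    have pos k := mulr_ge0 (ltW (r0 k)) (seminorm_ge0 y sp).
    have [nm|/ltnW nm] := leqP n m.
      have := tel y n (m - n)%N; rewrite subnKC// ler_norml => /andP[H _].
      by have := pos m; move: H; lra.
    have := tel y m (n - m)%N; rewrite subnKC// ler_norml => /andP[_ H].
    by have := pos n; move: H; lra.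
  (* Each [x n y] carries the error [r n * p y]. By [lo] the resulting intervals meet pairwise, and
     [l y] is the infimum of their upper ends. *)
  pose S y := [set x n y + r n * p y | n in [set: nat]].
  pose l y := inf (S y).
  have S0 y : S y !=set0 by exists (x 0 y + r 0 * p y), 0.
  have lx n y : `|l y - x n y| <= r n * p y.
    rewrite ler_norml; apply/andP; split.
      have : x n y - r n * p y <= l y.
        by apply: lb_le_inf => // _ [m _ <-]; exact: lo.
      by lra.
    have : l y <= x n y + r n * p y.
      apply: ge_inf; last by exists n.
      by exists (x 0 y - r 0 * p y) => _ [m _ <-]; exact: lo.
    by lra.
  have ll : scalar l.
    move=> a u v; apply/eqP; rewrite -subr_eq0 -normr_le0.
    (* Every [x n] is linear, so the linearity defect of [l] is at most a constant times [r n] for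
       all [n]. *)
    apply: (halving_le0 r0 rS (C := p (a *: u + v) + `|a| * p u + p v)) => n.
    have -> : l (a *: u + v) - (a * l u + l v) =
      (l (a *: u + v) - x n (a *: u + v)) - a * (l u - x n u) - (l v - x n v).
      by rewrite xl; lra.
    rewrite (le_trans (ler_normB _ _))// (le_trans (lerD (ler_normB _ _) (lexx _)))//.
    rewrite normrM.
    have := lx n (a *: u + v); have := lx n v.
    have := ler_wpM2l (normr_ge0 a) (lx n u); lra.
  exists l => n; exists (fun y => (r n)^-1 * (l y - x n y)).
    split=> [a u v|y]; first by rewrite ll xl; lra.
    by rewrite normrM gtr0_norm ?invr_gt0// ler_pdivrMl.
  apply/funext => y; rewrite -[RHS]/(r n * ((r n)^-1 * (l y - x n y))).
  by rewrite mulrA divff ?gt_eqF// mul1r.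
pose ev (a : E) (f : E -> R^o) : R := f a.
have [||n [c Bc]] := @disk_uniform_boundedness R (E -> R^o) B (fun=> ev @` A) aB cB.
- move=> _ _ [a _ <-]; split=> [//|].
  by exists (p a) => f [_ fp]; exact: fp.
- move=> f [fl fp].
  pose L : {linear E -> R^o} := HB.pack f (GRing.isLinear.Build R E R^o *:%R f fl).
  have [|c Lc] := wA L.
    move=> x; apply/cvgrPdist_lt => e e0.
    apply: filterS (continuous_seminorm_ball x cp e0) => y /=.
    apply: le_lt_trans; rewrite -(seminormN _ sp) opprB.
    by have := fp (x - y); rewrite -[f (x - y)]/(L (x - y)) linearB.
  exists (Num.bound `|c|) => _ [a Aa <-]; rewrite (le_trans (Lc a Aa))//.
  by rewrite (le_trans (ler_norm c))// ltW// archi_boundP.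
(* A functional in the polar with [f a = p a] turns the bound on evaluations into one on [p]. *)
exists c => a Aa; have [f [fl fp <-]] := hahn_banach a sp.
rewrite (le_trans (ler_norm _))//.
by apply: (Bc (ev a)) => //; exists a.
Qed.

(** * Derivatives as limits of difference quotients *)

Section disk_functional_ops.
Context {R : realType} {V : lmodType R} (B : set V).

Lemma disk_functionalZD (a : R) (f g : V -> R) : disk_functional B f ->
  disk_functional B g -> disk_functional B (fun x => a * f x + g x).
Proof.
move=> [fl [c fc]] [gl [d gd]]; split.
  by move=> b x y; rewrite fl gl; lra.
exists (`|a| * c + d) => x Bx; rewrite (le_trans (ler_normD _ _))//.
by rewrite normrM lerD// ?gd// ler_wpM2l// fc.
Qed.

Lemma disk_functional0 : disk_functional B (fun=> 0).
Proof.
split; first by move=> a x y; rewrite mulr0 addr0.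
by exists 0 => x _; rewrite normr0.
Qed.

Lemma disk_functionalZ (a : R) (f : V -> R) : disk_functional B f ->
  disk_functional B (fun x => a * f x).
Proof.
move=> fB; have := disk_functionalZD a fB disk_functional0.
by under eq_fun do rewrite addr0.
Qed.

Lemma disk_functionalB (f g : V -> R) : disk_functional B f ->
  disk_functional B g -> disk_functional B (fun x => f x - g x).
Proof.
move=> fB gB; have := disk_functionalZD (-1) gB fB.
by under eq_fun do rewrite mulN1r addrC.
Qed.

Lemma disk_functional_sum (n : nat) (a : 'I_n -> R) (f : 'I_n -> V -> R) :
  (forall i, disk_functional B (f i)) ->
  disk_functional B (fun x => \sum_i a i * f i x).
Proof.
move=> fB; elim: n a f fB => [|n IH] a f fB.
  by under eq_fun do rewrite big_ord0; exact: disk_functional0.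
under eq_fun do rewrite big_ord_recl.
by apply: disk_functionalZD => //; exact: IH.
Qed.

End disk_functional_ops.

Section frechet.
Context {R : realType} {X F : normedModType R}.

Lemma padl1 k (v : 'I_k.+1 -> X) : padl 1 (v ord0) (fun i => v (lift ord0 i)) = v.
Proof.
apply/funext => i; rewrite /padl; case: (split_ordP i) => j ->.
  by congr v; apply/val_inj; rewrite /= (ord1 j).
by congr v; apply/val_inj.
Qed.

Lemma lsym_eval_cvg k (l : nat -> Lsym k X F) (m : Lsym k X F) (v : 'I_k -> X) :
  l n @[n --> \oo] --> m -> l n v @[n --> \oo] --> m v.
Proof.
move=> lm; apply/cvgrPdist_le => e e0; pose C := \prod_i `|v i| + 1.
have C0 : 0 < C by rewrite ltr_wpDl// prodr_ge0.
have /cvgrPdist_le/(_ (e / C) (divr_gt0 e0 C0)) := lm.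
apply: filterS => n H; rewrite -[m v - l n v]/((m - l n) v).
rewrite (le_trans (opnormP _ _))//.
apply: (@le_trans _ _ (e / C * C)); last by rewrite divfK ?gt_eqF.
by rewrite ler_pM ?opnorm_ge0 ?prodr_ge0// lerDl.
Qed.

(** A sequence of steps is what Banach-Steinhaus takes. Differentiability gives the limit along
    [v ord0] in operator norm, and evaluation at the remaining directions is continuous. *)
Lemma frechet_derivs_cvg (U : set X) (f : U -> F) (D : jet X F X) k x
    (v : 'I_k.+1 -> X) : frechet_derivs f D -> U x ->
  n.+1%:R *: (D k (x + n.+1%:R^-1 *: v ord0) (fun i => v (lift ord0 i)) -
              D k x (fun i => v (lift ord0 i))) @[n --> \oo] --> D k.+1 x v.
Proof.
move=> [_ dD] Ux; have [dfx dE] := dD k x Ux.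
pose h := v ord0; pose w i := v (lift ord0 i).
have dk : t^-1 *: (D k (t *: h + x) - D k x) @[t --> (0 : R)^'] -->
    lsym_plug 1 (D (1 + k)%N x) h.
  by rewrite -[lsym_plug _ _ _]/((fun h => lsym_plug 1 (D (1 + k)%N x) h) h) -dE
    -deriveE//; exact: diff_derivable.
have inv0 : n.+1%:R^-1 @[n --> \oo] --> (0 : R)^'.
  move=> P /= P0; have := @cvg_harmonic R _ P0; apply: (@filterS _ \oo) => n; apply.
  by rewrite /harmonic /= invr_eq0 pnatr_eq0.
have H : n.+1%:R *: (D k (x + n.+1%:R^-1 *: h) - D k x) @[n --> \oo] -->
    lsym_plug 1 (D (1 + k)%N x) h.
  have -> : (fun n => n.+1%:R *: (D k (x + n.+1%:R^-1 *: h) - D k x)) =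
      (fun t : R => t^-1 *: (D k (t *: h + x) - D k x)) \o (fun n => n.+1%:R^-1).
    by apply/funext => n; rewrite /= invrK [x + _]addrC.
  exact: cvg_comp inv0 dk.
have := @lsym_eval_cvg k _ _ w H.
by rewrite -[lsym_plug _ _ _ w]/(D k.+1 x (padl 1 h w)) padl1.
Qed.

End frechet.

(** Openness along rays, at the steps of the difference quotients. Stated without a topology, it
    passes at once to traces on the spans [EB D]. *)
Definition radially_open (R : realType) (V : lmodType R) (U : set V) :=
  forall x h, U x -> exists N, forall n, (N <= n)%N -> U (x + n.+1%:R^-1 *: h).

(* The derivatives are iterated limits of difference quotients of values. *)
Lemma derivative_disk_functional (R : realType) (V : lmodType R) (B : set V)
    (X : normedModType R) (U : set X) (f : V -> U -> R^o) :
  absconvex B -> complete_disk B -> radially_open U ->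
  (forall e, frechet_smooth (f e)) ->
  (forall x, disk_functional B (fun e => f e x)) ->
  forall k x (v : 'I_k -> X), U x ->
    disk_functional B (fun e => xget 0 (frechet_derivs (f e)) k x v).
Proof.
move=> aB cB oU sf fB.
have dD e : frechet_derivs (f e) (xget 0 (frechet_derivs (f e))).
  by have [D DP] := sf e; exact: xgetPex (ex_intro _ D DP).
elim=> [|k IH] x v Ux.
  have := fB (exist _ x (mem_set Ux)); congr disk_functional.
  by apply/funext => e; have [/(_ (exist _ x (mem_set Ux)) v) <-] := dD e.
have [N UN] := oU x (v ord0) Ux.
pose q n e : R := n.+1%:R * (xget 0 (frechet_derivs (f e)) k
    (x + n.+1%:R^-1 *: v ord0) (fun i => v (lift ord0 i)) -
  xget 0 (frechet_derivs (f e)) k x (fun i => v (lift ord0 i))).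
(* The shift by [N] keeps all points of the quotients in [U], where the induction hypothesis
   applies. *)
apply: (@disk_functional_cvg _ _ B (fun n => q (n + N)%N)) => //.
  move=> n; apply: disk_functionalZ; apply: disk_functionalB; apply: IH => //.
  by apply: UN; rewrite leq_addl.
move=> e; have := @frechet_derivs_cvg _ _ _ _ _ _ _ _ v (dD e) Ux.
by rewrite -[X in X -> _](@cvg_shiftn N R^o (q ^~ e)).
Qed.

Lemma line_smooth (R : realType) (E : tvsType R) (x h : E) :
  smooth_curve (fun t : R => x + t *: h).
Proof.
exists (fun n t => if n is n'.+1 then if n' is _.+1 then 0 else h else x + t *: h) => //.
have near_cst (g : R -> E) (l : E) : (forall s : R, s != 0 -> g s = l) ->
    g s @[s --> (0 : R)^'] --> l.
  move=> gl; apply: (@cvg_trans _ (l @[s --> (0 : R)^'])); last exact: cvg_cst.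
  by apply: near_eq_cvg; near=> s; rewrite gl//; near: s; exact: nbhs_dnbhs_neq.
move=> [|[|n]] t; apply: near_cst => s s0; rewrite ?subrr ?scaler0//.
by rewrite opprD addrACA subrr add0r -scalerBl addrAC subrr add0r scalerA mulVf// scale1r.
Unshelve. all: by end_near. Qed.

Lemma cinfty_open_radial (R : realType) (E : tvsType R) (U : set E) :
  cinfty_open U -> radially_open U.
Proof.
move=> oU x h Ux; have := oU _ (line_smooth x h).
rewrite openE => /(_ 0) /=; rewrite scale0r addr0 => /(_ Ux).
move=> /(@cvg_harmonic R)[N _ NU]; exists N => n Nn.
exact: NU.
Qed.

(** * Jet norms and absorption *)

Section jet_tests.
Context {R : realType} {X : normedModType R} (M : nat -> R) (K : set X).
Hypothesis wM : weight_sequence M.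
Local Notation J := (jet X R^o K).
Implicit Types (g : J) (rho c : R).

Definition jet_weight rho m : R := m`!%:R * rho ^+ m * M m.

Lemma jet_weight_gt0 rho m : 0 < rho -> 0 < jet_weight rho m.
Proof.
move=> rho0; have [M0 _ _] := wM.
by rewrite !mulr_gt0 ?ltr0n ?fact_gt0 ?exprn_gt0.
Qed.

Lemma jet_weight_le rho rho' m : 0 < rho -> rho <= rho' ->
  jet_weight rho m <= jet_weight rho' m.
Proof.
move=> rho0 rr'; have [M0 _ _] := wM.
have rho'0 := lt_le_trans rho0 rr'.
by rewrite ler_pM2r// ler_pM2l ?ltr0n ?fact_gt0// lerXn2r ?nnegrE ?(ltW rho0) ?(ltW rho'0).
Qed.

(* The scalar quantities of order m whose suprema make up the norms
   jnorm_rho. *)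
Variant jet_test : nat -> (J -> R) -> Prop :=
| JetValue m (x : K) (v : 'I_m -> X) of (forall i, `|v i| <= 1) :
    jet_test m (fun g => g m x v)
| JetRemainder n k (x y : K) (v : 'I_k -> X) of
    x <> y & (forall i, `|v i| <= 1) :
    jet_test (n + k).+1
      (fun g => n.+1`!%:R / `|val x - val y| ^+ n.+1 * jrem g n k y x v).

Lemma sup0_le (A : set \bar R) c : 0 <= c ->
  (Defs.sup0 A <= c%:E)%E <-> forall a, A a -> (a <= c%:E)%E.
Proof.
move=> c0; split.
  move=> Ac a Aa; apply: le_trans Ac; apply: ereal_sup_ubound; by right.
by move=> Ac; apply: ge_ereal_sup => a [->|/Ac//]; rewrite lee_fin.
Qed.

Lemma opnorm_le k (l : Lsym k X R^o) c :
  `|l| <= c <-> forall v, (forall i, `|v i| <= 1) -> `|l v| <= c.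
Proof.
split=> [lc v v1|lc]; first by apply: le_trans lc; exact: opnorm_ub.
apply: sup_le_ub; first exact: (opnorm_has_sup l).1.
by move=> _ [v v1 <-]; exact: lc.
Qed.

(** Replaces suprema in the extended reals by bounds on the linear functionals [psi], the form that
    uniform boundedness handles. *)
Lemma jnorm_rho_le rho c g : 0 < rho -> 0 <= c ->
  (jnorm_rho M rho g <= c%:E)%E <->
  forall m psi, jet_test m psi -> `|psi g| <= c * jet_weight rho m.
Proof.
move=> rho0 c0; have w0 m := jet_weight_gt0 m rho0.
have cw0 m : 0 <= c * jet_weight rho m by rewrite mulr_ge0// ltW.
have rem0 (x y : K) n : x <> y -> 0 < n.+1`!%:R / `|val x - val y| ^+ n.+1 :> R.
  move=> xy; rewrite divr_gt0 ?ltr0n ?fact_gt0// exprn_gt0// normr_gt0 subr_eq0.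
  by apply/eqP => /val_inj.
rewrite /jnorm_rho ge_max; split.
  move=> /andP[/(sup0_le _ c0) H1 /(sup0_le _ c0) H2] _ _ [].
    move=> m x v v1; have := H1 _ (ex_intro2 _ _ m I erefl).
    rewrite lee_pdivrMr ?w0// -EFinM => /(sup0_le _ (cw0 m)) H.
    by have := H _ (ex_intro2 _ _ x I erefl); rewrite lee_fin => /opnorm_le; exact.
  move=> n k x y v xy v1; have := H2 _ (ex_intro2 _ _ (n, k) I erefl).
  rewrite /= lee_pdivrMr ?(w0 (n + k).+1)// -EFinM => /(sup0_le _ (cw0 _)) H.
  have := H _ (ex_intro2 _ _ (x, y) xy erefl); rewrite lee_fin /= mulrAC => H'.
  rewrite normrM gtr0_norm ?rem0//; apply: le_trans H'.
  by rewrite ler_pM2l ?rem0//; exact: (@opnorm_ub _ _ _ _ (jrem g n k y x)).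
move=> H; apply/andP; split; apply/sup0_le => //.
  move=> _ [m _ <-]; rewrite lee_pdivrMr ?w0// -EFinM; apply/sup0_le => [|_ [x _ <-]].
    exact: cw0.
  rewrite lee_fin; apply/opnorm_le => v v1.
  exact: (H _ _ (JetValue x v1)).
move=> _ [[n k] _ <-]; rewrite /= lee_pdivrMr ?(w0 (n + k).+1)// -EFinM.
apply/sup0_le => [|_ [[x y] xy <-]]; first exact: (cw0 (n + k).+1).
rewrite lee_fin /= mulrAC.
rewrite -ler_pdivlMl ?rem0//; apply/opnorm_le => v v1.
rewrite ler_pdivlMl ?rem0//.
by have := H _ _ (JetRemainder n xy v1); rewrite normrM gtr0_norm ?rem0.
Qed.

Lemma lsym_sum k n (l : 'I_n -> Lsym k X R^o) (v : 'I_k -> X) :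
  (\sum_i l i) v = \sum_i l i v :> R.
Proof. by elim/big_rec2 : _ => // i a b _ <-. Qed.

Lemma jrem_eval g n k (x y : K) (v : 'I_k -> X) : jrem g n k y x v =
  g k x v - \sum_(j < n.+1) j`!%:R^-1 * g (j + k)%N y (padl j (val x - val y) v)
  :> R.
Proof.
have -> : jrem g n k y x v = g k x v - (\sum_(j < n.+1) j`!%:R^-1 *:
  lsym_plug j (g (j + k)%N y) (val x - val y)) v by [].
by rewrite lsym_sum.
Qed.

Section families.
Context {V : lmodType R} (S : V -> J).

Lemma jet_test_disk_functional (B : set V) m psi :
  (forall k x (v : 'I_k -> X), disk_functional B (fun e => S e k x v)) ->
  jet_test m psi -> disk_functional B (fun e => psi (S e)).
Proof.
move=> SB [{}m x v _|n k x y v _ _]; first exact: SB.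
under eq_fun do rewrite jrem_eval.
apply: disk_functionalZ; apply: disk_functionalB; first exact: SB.
by apply: disk_functional_sum => j; exact: SB.
Qed.

(** Serves both flavours: a constant [rho] for Beurling, [rho n = n + 1] for Roumieu. The family
    consists of the tests divided by their weights, so a norm at most [n] means values at most
    [n]. *)
Lemma CM_rho_uniformly_bounded (B : set V) (rho : nat -> R) :
  absconvex B -> complete_disk B -> (forall n, 0 < rho n) ->
  (forall k x (v : 'I_k -> X), disk_functional B (fun e => S e k x v)) ->
  (forall e, exists n, (jnorm_rho M (rho n) (S e) <= n%:R%:E)%E) ->
  exists n c, forall e, B e -> forall m psi, jet_test m psi ->
    `|psi (S e)| <= c * jet_weight (rho n) m.
Proof.
move=> aB cB rho0 SB Sfin.
pose Phi n := [set f : V -> R | exists m psi, jet_test m psi /\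
  f = fun e => (jet_weight (rho n) m)^-1 * psi (S e)].
have w0 n m := jet_weight_gt0 m (rho0 n).
have [||n [c Bc]] := @disk_uniform_boundedness _ _ B Phi aB cB.
- move=> n _ [m [psi [mpsi ->]]]; apply: disk_functionalZ.
  exact: jet_test_disk_functional mpsi.
- move=> e Be; have [n Sen] := Sfin e; exists n => _ [m [psi [mpsi ->]]].
  rewrite normrM gtr0_norm ?invr_gt0// ler_pdivrMl// mulrC.
  by move/(jnorm_rho_le _ (rho0 n) (ler0n R n)) : Sen; exact.
exists n, c => e Be m psi mpsi.
have := Bc _ (ex_intro _ m (ex_intro _ psi (conj mpsi erefl))) e Be.
by rewrite normrM gtr0_norm ?invr_gt0// ler_pdivrMl// mulrC.
Qed.

End families.
End jet_tests.

Section absorption.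
Context {R : realType} {E : lmodType R} (A : set E).

(* Unlike absorption by a single multiple, this defines a filter of sets N
   without assuming them to be balanced. *)
Definition absorbed (V : lmodType R) (S : E -> V) (N : set V) :=
  exists2 s0 : R, 0 < s0 & forall s a, 0 < s -> s <= s0 -> A a -> N (S (s *: a)).

Lemma absorbed_filter (V : lmodType R) (S : E -> V) : Filter (absorbed S).
Proof.
split.
- by exists 1.
- move=> P Q [s s0 sP] [t t0 tQ]; exists (Num.min s t); first by rewrite lt_min s0.
  move=> u a u0; rewrite le_min => /andP[us ut] Aa.
  by split; [exact: sP|exact: tQ].
- by move=> P Q PQ [s s0 sP]; exists s => // u a u0 us Aa; exact/PQ/sP.
Qed.

(** The initial neighbourhoods form the smallest filter containing the preimages, and the absorbed
    sets form a filter, so checking the preimages is enough. *)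
Lemma absorbed_initial (V : lmodType R) (S : E -> V) (C : set V) (I : Type)
    (D : set I) (W : I -> lmodType R) (f : forall i, V -> W i)
    (Y : forall i, lcs (W i)) :
  (forall i N, D i -> lcs_nbhs0 (Y i) N -> absorbed (fun e => f i (S e)) N) ->
  forall N, lcs_nbhs0 (lcs_initial C D f Y) N -> absorbed S N.
Proof.
move=> fS N; apply; split; first exact: absorbed_filter.
by move=> _ [i Di [N' YN' <-]]; have [s s0 sN] := fS i N' Di YN'; exists s.
Qed.

Lemma absorbed_bounded (V : lmodType R) (Y : lcs V) (S : {linear E -> V}) :
  (forall e, lcs_carrier Y (S e)) ->
  (forall N, lcs_nbhs0 Y N -> absorbed S N) -> lcs_bounded Y (S @` A).
Proof.
move=> SY absS; split; first by move=> _ [a _ <-].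
move=> N /absS[s s0 sN]; exists s^-1; first by rewrite invr_gt0.
move=> _ [a Aa <-]; exists (S (s *: a)); first exact: sN.
by rewrite linearZ scalerA mulVf ?gt_eqF// scale1r.
Qed.

End absorption.

Lemma absorbed_CM_rho (R : realType) (E : lmodType R) (A : set E)
    (X : normedModType R) (M : nat -> R) (K : set X) (S : E -> jet X R^o K)
    (rho c : R) : weight_sequence M -> 0 < rho ->
  (forall e k, continuous (S e k)) ->
  (forall m psi, jet_test m psi -> scalar (fun e => psi (S e))) ->
  (forall e, A e -> forall m psi, jet_test m psi ->
    `|psi (S e)| <= c * jet_weight M rho m) ->
  forall N, lcs_nbhs0 (CM_rho M K rho) N -> absorbed A S N.
Proof.
move=> wM rho0 Sc Sl Ac N [e e0 eN].
have d0 : 0 < `|c| + 1 by rewrite ltr_wpDl.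
(* Chosen so that [s * c] is at most [e / 2], which leaves a strict inequality below [e]. *)
exists (e / 2 / (`|c| + 1)); first by rewrite !divr_gt0.
move=> s a s0 sd Aa; apply: eN.
have : (jnorm_rho M rho (S (s *: a)) <= (e / 2)%:E)%E.
  apply/jnorm_rho_le => //; first by rewrite divr_ge0// ltW.
  move=> m psi mpsi; rewrite (scalar_funZ _ _ (Sl m psi mpsi)) normrM gtr0_norm//.
  have w0 := jet_weight_gt0 wM m rho0.
  apply: (@le_trans _ _ (s * (c * jet_weight M rho m))).
    by rewrite ler_pM2l//; exact: Ac.
  rewrite mulrA ler_pM2r//; apply: le_trans (_ : s * (`|c| + 1) <= _).
    by rewrite ler_pM2l// (le_trans (ler_norm c))// lerDl.
  by rewrite -ler_pdivlMr.
move=> H; split; first by split; [exact: Sc|exact: le_lt_trans H (ltry _)].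
by apply: (le_lt_trans H); rewrite lte_fin; lra.
Qed.

Lemma lt_ey_nat (R : realType) (x : \bar R) : (x < +oo)%E ->
  exists n : nat, (x <= n%:R%:E)%E.
Proof.
case: x => [r _|//|_]; last by exists 0; rewrite leNye.
exists (Num.bound `|r|); rewrite lee_fin (le_trans (ler_norm r))// ltW//.
exact: archi_boundP.
Qed.

(** In the projective limit each [rho] is treated separately. In the inductive limit, uniform
    boundedness puts the image of [B] into one step with a common bound, and a neighbourhood of 0
    contains one of that step. *)
Lemma absorbed_CM_compact (R : realType) (E : lmodType R) (A B : set E)
    (X : normedModType R) (M : nat -> R) (K : set X) (b : flavour)
    (S : E -> jet X R^o K) :
  weight_sequence M -> absconvex B -> complete_disk B -> A `<=` B ->
  (forall k x (v : 'I_k -> X), disk_functional B (fun e => S e k x v)) ->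
  (forall e, lcs_carrier (CM_compact M K b) (S e)) ->
  forall N, lcs_nbhs0 (CM_compact M K b) N -> absorbed A S N.
Proof.
move=> wM aB cB AB SB.
have Sl m psi (H : jet_test m psi) := (jet_test_disk_functional SB H).1.
case: b => Sb.
  have Sc e k : continuous (S e k) by have [_ /(_ 1 ltr01)[]] := Sb e.
  apply: (@absorbed_initial _ _ A (jet X R^o K) S setT R [set rho | 0 < rho]
    (fun=> jet X R^o K) (fun=> id) (fun rho => CM_rho M K rho)) => rho N rho0 NN.
  have [|n [c Bc]] := CM_rho_uniformly_bounded wM aB cB (rho := fun=> rho) (fun=> rho0) SB.
    by move=> e; have [_ /(_ rho rho0)[_ /lt_ey_nat]] := Sb e.
  by apply: (absorbed_CM_rho wM rho0 Sc Sl (c := c)) NN => e /AB; exact: Bc.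
have Sc e k : continuous (S e k) by have [rho _ []] := Sb e.
move=> N [A' [_ _ A'nbhs A'N]].
have n0 n : 0 < n.+1%:R :> R by [].
have [|n [c Bc]] := CM_rho_uniformly_bounded wM aB cB n0 SB.
  move=> e; have [rho rho0 [_ /lt_ey_nat[m Sm]]] := Sb e.
  (* One index must dominate both the bound on the norm and [rho] itself. *)
  pose n := maxn m (Num.bound rho).
  exists n; apply/jnorm_rho_le => // k psi kpsi.
  move/(jnorm_rho_le wM _ rho0 (ler0n R m)) : Sm => /(_ k psi kpsi) /le_trans; apply.
  have rn : rho <= n.+1%:R.
    rewrite (le_trans (ltW (archi_boundP (ltW rho0))))// ler_nat.
    by rewrite leqW// leq_maxr.
  apply: ler_pM => //; first exact/ltW/jet_weight_gt0.
    by rewrite ler_nat leq_maxl.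
  exact: jet_weight_le.
have := absorbed_CM_rho wM (n0 n) Sc Sl (fun e Ae => Bc e (AB e Ae)) (A'nbhs _ (n0 n)).
by apply: (@filterS _ _ (absorbed_filter A S)).
Qed.

(** * Point evaluations on jet spaces *)

Section point_evaluation_nbhs.
Context {R : realType} {X : normedModType R} (M : nat -> R) (K : set X).
Hypothesis wM : weight_sequence M.
Local Notation J := (jet X R^o K).

(** Over the empty set boundedness is void, so the result on families, applied to the identity,
    yields linearity. *)
Lemma jet_test_scalar m (psi : J -> R) : jet_test m psi -> scalar psi.
Proof.
move=> H; have [//|//] := @jet_test_disk_functional _ _ _ J id set0 m psi _ H.
by move=> k x v; split=> [//|]; exists 0.
Qed.

(** The weight of order 0 is [M 0 = 1], so for every [rho] the open unit ball of [jnorm_rho] lies in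
    this set. *)
Lemma jet_value_nbhs0 (x : K) (v : 'I_0 -> X) (b : flavour) :
  lcs_nbhs0 (CM_compact M K b) [set g : J | `|g 0 x v| <= 1].
Proof.
have Nrho rho : 0 < rho -> forall g : J,
    (jnorm_rho M rho g < 1%:E)%E -> `|g 0 x v| <= 1.
  move=> rho0 g /ltW /(jnorm_rho_le wM _ rho0 ler01).
  have v1 i : `|v i| <= 1 by case: i.
  move=> /(_ _ _ (JetValue x v1)); have [_ M0 _] := wM.
  by rewrite /jet_weight expr0 M0 !mulr1.
case: b => /=.
  move=> Fi [_]; apply; exists 1; first exact: ltr01.
  exists [set g : J | `|g 0 x v| <= 1] => //.
  by exists 1 => // g [_ /Nrho]; exact.
pose Y := \bigcup_(rho in [set rho : R | 0 < rho]) lcs_carrier (CM_rho M K rho : lcs J).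
(* Neighbourhoods in the inductive limit come from absolutely convex sets inside the union of the
   steps. *)
exists (Y `&` [set g : J | `|g 0 x v| <= 1]); split; last by move=> g [].
- split.
    have n01 : `|0 : R^o| <= 1 :> R by rewrite normr0.
    exists 0; split; last exact: n01.
    exists 1; first exact: ltr01.
    split; first by move=> k; exact: (@cst_continuous _ _ (0 : Lsym k X R^o)).
    apply: (@le_lt_trans _ _ 0%:E); last exact: ltry.
    apply/jnorm_rho_le => // m psi /jet_test_scalar/scalar_fun0 ->.
    by rewrite normr0 mul0r.
  move=> a c g h ac [[rho rho0 [gc /lt_ey_nat[n gn]]] g1] [[tau tau0 [hc /lt_ey_nat[p hp]]] h1].
  split; last first.
    rewrite /= -[(_ + _) _]/(a * g 0 x v + c * h 0 x v).
    rewrite (le_trans (ler_normD _ _))// !normrM (le_trans _ ac)//.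
    by rewrite lerD// ler_piMr.
  (* Weights grow with [rho], so jets from two steps lie together in the larger one. *)
  have s0 : 0 < Num.max rho tau by rewrite lt_max rho0.
  exists (Num.max rho tau) => //; split.
    move=> k; suff : continuous (fun y => a *: g k y + c *: h k y) by [].
    move=> y.
    have ag : a *: g k z @[z --> y] --> a *: g k y by exact: cvgZ (cvg_cst a) (gc k y).
    have ch : c *: h k z @[z --> y] --> c *: h k y by exact: cvgZ (cvg_cst c) (hc k y).
    exact: cvgD ag ch.
  apply: (@le_lt_trans _ _ (`|a| * n%:R + `|c| * p%:R)%:E); last exact: ltry.
  apply/jnorm_rho_le => // m psi mpsi; have psil := jet_test_scalar mpsi.
  rewrite (scalar_funD _ _ psil) !(scalar_funZ _ _ psil).
  rewrite (le_trans (ler_normD _ _))// !normrM mulrDl -!mulrA.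
  move/(jnorm_rho_le wM _ rho0 (ler0n R n)) : gn => /(_ m psi mpsi) gn.
  move/(jnorm_rho_le wM _ tau0 (ler0n R p)) : hp => /(_ m psi mpsi) hp.
  apply: lerD; rewrite ler_wpM2l//.
    rewrite (le_trans gn)// ler_wpM2l// jet_weight_le//.
    by rewrite le_max lexx.
  rewrite (le_trans hp)// ler_wpM2l// jet_weight_le//.
  by rewrite le_max lexx orbT.
- by move=> g [].
- move=> rho rho0; exists 1 => // g [gX g1]; split; first by exists rho.
  exact: (Nrho rho).
Qed.

End point_evaluation_nbhs.

Lemma trace_radial (R : realType) (F : convenientType R) (U : set F) (D : bdisk F) :
  radially_open U -> radially_open (@trace _ _ U D).
Proof. by move=> oU x h Ux; exact: (oU (EB_incl x) (EB_incl h) Ux). Qed.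

(** [CM] tests maps along spans of disks; this disk has [x] in its span. *)
Definition point_bdisk (R : realType) (F : convenientType R) (x : F) : bdisk F.
Proof.
apply: (@MkBdisk _ _ (disk_hull [set x])).
- exact: disk_hull_closed.
- exact: disk_hull_absconvex.
- apply: disk_hull_bounded; apply: seminorm_bounded => p _.
  by exists (p x) => _ ->.
Defined.

Lemma point_bdiskP (R : realType) (F : convenientType R) (x : F) :
  x \in EB_pred (point_bdisk x).
Proof. by apply/mem_set => S [_]; apply; exact: sub_disk_hull. Qed.

(** * The uniform boundedness principle *)

(** Absorption is traced through two initial structures, over functionals and disks and then over
    compact sets, down to jets on one [K]. The pointwise hypothesis bounds each [l (T e x)] on the
    hull of [A]. *)
Lemma bounded_of_pointwise_bounded (R : realType) (M : nat -> R)
    (b : flavour) (E F G : convenientType R) (U : set F)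
    (T : {linear E -> (U -> G)}) :
  weight_sequence M -> cinfty_open U ->
  (forall e : E, lcs_carrier (CM G M b U) (T e)) ->
  (forall x : U, bounded_map (lcs_of_tvs E) (lcs_of_tvs G) (fun e => T e x)) ->
  bounded_map (lcs_of_tvs E) (CM G M b U) T.
Proof.
move=> wM oU TU Tx A bA; apply: absorbed_bounded => //.
have aB := disk_hull_absconvex A; have cB := disk_hull_complete bA.
have bB := disk_hull_bounded bA.
apply: absorbed_initial => -[l D] N /= lc; move: N.
pose tr := @trace _ _ U D.
pose f e (x : tr) : R^o := l (T e (trace_incl x)).
have fsmooth e : lcs_carrier (CM_open M tr b) (f e).
  by have [_ /(_ (l, D) lc)] := TU e.
apply: (@absorbed_initial _ _ A (tr -> R^o) f (@frechet_smooth _ _ _ tr) (set (EB D))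
  [set K | [/\ compact K, convex_set K & K `<=` tr]]
  (fun K => jet (EB D) R^o K) (fun K => @jinf _ _ _ tr K)
  (fun K => CM_compact M K b)) => K N KP KN.
have [_ _ KU] := KP.
apply: (absorbed_CM_compact (S := fun e => jinf (K := K) (f e)) wM aB cB (@sub_disk_hull _ _ A) _ _ KN).
  move=> k x v; apply: (derivative_disk_functional aB cB).
  - exact: trace_radial (cinfty_open_radial oU).
  - by move=> e; have [] := fsmooth e.
  - move=> {}x; split.
      move=> a e e'; rewrite /f linearP.
      by rewrite -[(_ + _) _]/(a *: T e (trace_incl x) + T e' (trace_incl x)) linearP.
    have [c _ Bc] := bounded_seminorm (Tx (trace_incl x) _ bB)
      (normr_continuous_seminorm lc).
    by exists c => e Be; apply: Bc; exists e.
  - exact: KU (set_mem (valP x)).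
move=> e; have [_] := fsmooth e; exact.
Qed.

(** Evaluation at [x] is the order 0 part of the jet on the compact set consisting of [x] alone, in
    the span of its disk. Hence [N] is a neighbourhood of 0 and absorbs the image of [A]. *)
Lemma weakly_pointwise_bounded (R : realType) (M : nat -> R)
    (b : flavour) (E F G : convenientType R) (U : set F)
    (T : {linear E -> (U -> G)}) (A : set E) (x : U) (l : {linear G -> R^o}) :
  weight_sequence M -> (forall e : E, lcs_carrier (CM G M b U) (T e)) ->
  lcs_bounded (CM G M b U) (T @` A) -> continuous l ->
  exists c : R, forall a, A a -> `|l (T a x)| <= c.
Proof.
move=> wM TU [_ bTA] lc; pose D := point_bdisk (val x).
pose x' : EB D := MkEB (point_bdiskP (val x)).
have Ux' : @trace _ _ U D x' by exact: (set_mem (valP x)).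
pose xt : @trace _ _ U D := exist _ x' (mem_set Ux').
have xtE : trace_incl xt = x by exact/val_inj.
pose K := [set x'].
pose xK : K := exist _ x' (mem_set (erefl x' : K x')).
pose f e (y : @trace _ _ U D) : R^o := l (T e (trace_incl y)).
pose v (i : 'I_0) : EB D := 0.
have fx e : jinf (K := K) (f e) 0 xK v = l (T e x).
  have [_ /(_ (l, D) lc)[[d dP] _]] := TU e.
  have [H _] := @xgetPex _ 0 (frechet_derivs (f e)) (ex_intro _ d dP).
  by rewrite /jinf /= (H xt v) /f xtE.
pose N := [set g : U -> G |
  `|jinf (K := K) (fun y : @trace _ _ U D => l (g (trace_incl y)) : R^o) 0 xK v| <= 1].
have [|r r0 rN] := bTA N.
  (* In each initial structure in turn the set is a preimage of one in the next, down to the jets on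
     [K]. *)
  move=> Fi [FFi]; apply; exists (l, D) => //.
  exists [set g : @trace _ _ U D -> R^o | `|jinf (K := K) g 0 xK v| <= 1] => //.
  move=> Fi' [FFi']; apply; exists K.
    split; first exact: compact_set1.
      by move=> y z t /set_mem -> /set_mem ->; apply/mem_set; rewrite convmm.
    by move=> _ ->.
  by exists [set g : jet (EB D) R^o K | `|g 0 xK v| <= 1] => //; exact: jet_value_nbhs0.
exists r => a Aa; have [g Ng gE] := rN _ (imageP T Aa).
(* By linearity [g] is again a value of [T], so [fx] computes its jet at [x]. *)
have gT : g = T (r^-1 *: a) by rewrite linearZ /= -gE scalerA mulVf ?gt_eqF// scale1r.
have : `|l (T (r^-1 *: a) x)| <= 1 by rewrite -fx /f -gT.
have -> : T (r^-1 *: a) x = r^-1 *: T a x by rewrite linearZ.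
rewrite linearZ /=.
by rewrite normrM gtr0_norm ?invr_gt0// ler_pdivrMl// mulr1.
Qed.

Theorem theorem6p1 (R : realType) (M : nat -> R) (wM : weight_sequence M)
    (b : flavour) (E F G : convenientType R) (U : set F) (oU : cinfty_open U)
    (T : {linear E -> (U -> G)})
    (TU : forall e : E, lcs_carrier (CM G M b U) (T e)) :
  bounded_map (lcs_of_tvs E) (CM G M b U) T <->
  forall x : U, bounded_map (lcs_of_tvs E) (lcs_of_tvs G) (fun e => T e x).
Proof.
split=> [bT x A bA|]; last exact: bounded_of_pointwise_bounded.
apply: weakly_bounded => l lc.
have [c Ac] := weakly_pointwise_bounded x wM TU (bT A bA) lc.
by exists c => _ [a Aa <-]; exact: Ac.
Qed.
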